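(* Let $d\ge 2$, let $\|\cdot\|_D$ be a $D$-norm on $\mathbb{R}^d$ having partial derivatives of order $d$ on $(-\infty,0)^d$, and let $\boldsymbol{\eta}=(\eta_1,\dots,\eta_d)$ be a random vector with distribution function $G(\boldsymbol{x})=\exp(-\|\boldsymbol{x}\|_D)$, $\boldsymbol{x}\le\boldsymbol{0}$. Let $\boldsymbol{X}=(X_1,\dots,X_d)$ be a random vector with distribution function $F$, marginal distribution functions $F_1,\dots,F_d$ and a copula $C$, i.e. $F(\boldsymbol{x})=C(F_1(x_1),\dots,F_d(x_d))$. Suppose that one of the following holds: (a) $C$ is a generalized Pareto copula with corresponding $D$-norm $\|\cdot\|_D$, i.e. there is $\boldsymbol{u}_0\in(0,1)^d$ with $C(\boldsymbol{u})=1-\|\boldsymbol{1}-\boldsymbol{u}\|_D$ for all $\boldsymbol{u}\in[\boldsymbol{u}_0,\boldsymbol{1}]$; or (b) $C(\boldsymbol{u}) = 1-\|\boldsymbol{1}-\boldsymbol{u}\|_D + o(\|\boldsymbol{1}-\boldsymbol{u}\|)$ as $\boldsymbol{u}\to\boldsymbol{1}$, uniformly for $\boldsymbol{u}\in[0,1]^d$, and for each nonempty set of distinct indices $\{i_1,\dots,i_k\}\subseteq\{1,\dots,d\}$ and all $\boldsymbol{x}<\boldsymbol{0}$, $$\frac{\partial^k}{\partial x_{i_1}\cdots\partial x_{i_k}}\, n\left(C\left(\boldsymbol{1}+\frac{\boldsymbol{x}}{n}\right)-1\right)\longrightarrow \frac{\partial^k}{\partial x_{i_1}\cdots\partial x_{i_k}}\bigl(-\|\boldsymbol{x}\|_D\bigr)\qquad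 (n\to\infty),$$ where the partial derivatives on the left-hand side are understood to exist for all sufficiently large $n$. Let $\boldsymbol{X}^{(1)},\boldsymbol{X}^{(2)},\dots$ be independent copies of $\boldsymbol{X}$ and $\boldsymbol{M}^{(n)}=\left(\max_{1\le i\le n}X_1^{(i)},\dots,\max_{1\le i\le n}X_d^{(i)}\right)$. Then, as $n\to\infty$, $$\sup_{A\in\mathbb{B}^d}\left|P\left(\boldsymbol{M}^{(n)}\in A\right)-P\left(\left(F_1^{-1}\left(1+\tfrac1n\eta_1\right),\dots,F_d^{-1}\left(1+\tfrac1n\eta_d\right)\right)\in A\right)\right|\longrightarrow 0,$$ where $\mathbb{B}^d$ is the Borel $\sigma$-field of $\mathbb{R}^d$.
   Context: All operations and inequalities between vectors are componentwise; $\boldsymbol{0}=(0,\dots,0)$, $\boldsymbol{1}=(1,\dots,1)$. A norm $\|\cdot\|_D$ on $\mathbb{R}^d$ is a $D$-norm if there is a random vector $\boldsymbol{Z}=(Z_1,\dots,Z_d)$ with $Z_i\ge 0$ and $E(Z_i)=1$ for $1\le i\le d$ such that $\|\boldsymbol{x}\|_D=E\left(\max_{1\le i\le d}|x_i|Z_i\right)$ for all $\boldsymbol{x}\in\mathbb{R}^d$. For every $D$-norm, $\exp(-\|\boldsymbol{x}\|_D)$, $\boldsymbol{x}\le\boldsymbol{0}$, defines a distribution function concentrated on $(-\infty,0]^d$ with standard negative exponential margins. A copula on $\mathbb{R}^d$ is the distribution function of a random vector whose components are each uniformly distributed on $[0,1]$. In (b), $\|\cdot\|$ is an arbitrary norm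 on $\mathbb{R}^d$. $F_j^{-1}(q):=\inf\{t\in\mathbb{R}: F_j(t)\ge q\}$, $q\in(0,1)$, is the generalized inverse (quantile function); for $q\notin(0,1)$, $F_j^{-1}(q)$ is set to an arbitrary fixed real number (the event $1+\eta_j/n\notin(0,1)$ has probability tending to $0$). *)

(* Defs.v *)
From HB Require Import structures.
From mathcomp Require Import all_boot all_order all_algebra finmap.
From mathcomp Require Import all_classical all_reals all_analysis.

Set Implicit Arguments.
Unset Strict Implicit.
Unset Printing Implicit Defensive.

Import Order.TTheory GRing.Theory Num.Theory.
Import numFieldNormedType.Exports.

Local Open Scope classical_set_scope.
Local Open Scope ring_scope.

(* Points of R^d are row vectors; a random vector is the family of its
   components, all defined on the same probability space. *)

Section Norms.
Context {R : realType} {d : nat}.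

Record is_norm (N : 'rV[R]_d -> R) : Prop := IsNorm {
  is_norm_eq0 : forall x, N x = 0 -> x = 0;
  is_normZ : forall a x, N (a *: x) = `|a| * N x;
  is_normD : forall x y, N (x + y) <= N x + N y
}.

(* The base value 0 of the iterated maximum is harmless: every term is
   nonnegative. *)
Definition is_Dnorm (N : 'rV[R]_d -> R) : Prop :=
  is_norm N /\
  exists (dZ : measure_display) (OZ : measurableType dZ)
         (PZ : probability OZ R) (Z : 'I_d -> {RV PZ >-> R}),
    [/\ forall i w, 0 <= Z i w,
        forall i, ('E_PZ[Z i] = 1)%E &
        forall x : 'rV[R]_d,
          ('E_PZ[fun w => (\big[Num.max/0]_(i < d) (`|x 0 i| * Z i w))%R]
            = (N x)%:E)%E].

End Norms.

Section PartialDerivatives.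
Context {R : realType} {d : nat}.
Implicit Types (s : seq 'I_d) (f : 'rV[R]_d -> R) (x : 'rV[R]_d).

(* partial [:: i1; ...; ik] f is the iterated partial derivative of f taken
   first in the variable ik and last in the variable i1. *)
Fixpoint partial s f : 'rV[R]_d -> R :=
  if s is i :: s' then fun x => 'D_(delta_mx 0 i) (partial s' f) x else f.

(* 'D_v is total, so existence is a separate predicate: the next lower
   derivative has to exist on a neighbourhood of x and to be derivable at x. *)
Fixpoint has_partial s f x : Prop :=
  if s is i :: s' then
    (\forall y \near x, has_partial s' f y) /\
    derivable (partial s' f) x (delta_mx 0 i)
  else True.

(* Existence of every partial derivative of order k, repeated indices
   allowed; by has_partial those of lower order then exist as well. *)
Definition has_partials_of_order (k : nat) f (A : set 'rV[R]_d) : Prop :=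
  forall s, size s = k -> forall x, A x -> has_partial s f x.

Definition neg_orthant : set 'rV[R]_d := [set x | forall i, x 0 i < 0].

Definition unit_cube : set 'rV[R]_d := [set u | forall i, 0 <= u 0 i <= 1].

End PartialDerivatives.

Section RandomVectors.
Context {R : realType} {d : nat}.

Definition borel : set (set 'rV[R]_d) := <<s [set A | open A] >>.

Context {dO : measure_display} {Om : measurableType dO} {P : probability Om R}.

Definition rvec (X : 'I_d -> {RV P >-> R}) (w : Om) : 'rV[R]_d :=
  \row_j X j w.

Definition joint_cdf (X : 'I_d -> {RV P >-> R}) (x : 'rV[R]_d) : R :=
  fine (P [set w | forall j, X j w <= x 0 j]).

Definition marginal_cdf (X : {RV P >-> R}) (t : R) : R := fine (cdf X t).

Local Open Scope ereal_scope.

Definition independent_vectors (Xs : nat -> 'I_d -> {RV P >-> R}) : Prop :=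
  forall (J : {fset nat}) (A : nat -> set 'rV[R]_d),
    (forall i, borel (A i)) ->
    P (\bigcap_(i in [set` J]) (rvec (Xs i) @^-1` A i)) =
    \prod_(i <- J) P (rvec (Xs i) @^-1` A i).

End RandomVectors.

Definition equal_in_law {R : realType} {d : nat}
    {dO : measure_display} {Om : measurableType dO} {P : probability Om R}
    {dO' : measure_display} {O' : measurableType dO'} {P' : probability O' R}
    (Y : 'I_d -> {RV P >-> R}) (X : 'I_d -> {RV P' >-> R}) : Prop :=
  forall A, borel A -> P (rvec Y @^-1` A) = P' (rvec X @^-1` A).

Section Copulas.
Context {R : realType} {d : nat}.
Implicit Types (C N nrm : 'rV[R]_d -> R).

Definition is_copula C : Prop :=
  exists (dU : measure_display) (OU : measurableType dU)
         (PU : probability OU R) (U : 'I_d -> {RV PU >-> R}),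
    (forall i (B : set R), measurable B ->
       distribution PU (U i) B = uniform_prob (@ltr01 R) B) /\
    C = joint_cdf U.

Definition has_copula {dO : measure_display} {Om : measurableType dO}
    {P : probability Om R} (X : 'I_d -> {RV P >-> R}) C : Prop :=
  forall x : 'rV[R]_d,
    joint_cdf X x = C (\row_j marginal_cdf (X j) (x 0 j)).

Definition is_generalized_Pareto C N : Prop :=
  exists u0 : 'rV[R]_d, (forall i, 0 < u0 0 i < 1) /\
    forall u : 'rV[R]_d, (forall i, u0 0 i <= u 0 i <= 1) ->
      C u = 1 - N (const_mx 1 - u).

Definition copula_expansion C N nrm : Prop :=
  (fun u : 'rV[R]_d => C u - (1 - N (const_mx 1 - u)) : R^o)
  =o_ (within unit_cube (nbhs (const_mx 1 : 'rV[R]_d)))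
  (fun u : 'rV[R]_d => nrm (const_mx 1 - u) : R^o).

Definition rescaled_copula C (n : nat) (x : 'rV[R]_d) : R :=
  n%:R * (C (const_mx 1 + n%:R^-1 *: x) - 1).

(* A duplicate-free sequence is a set of distinct indices together with an
   order of differentiation; all orders are covered.  The rank from which the
   derivative of rescaled_copula exists may depend on the point x. *)
Definition copula_derivatives_converge C N : Prop :=
  forall s : seq 'I_d, s != [::] -> uniq s ->
  forall x : 'rV[R]_d, neg_orthant x ->
    (\forall n \near \oo, has_partial s (rescaled_copula C n) x) /\
    partial s (rescaled_copula C n) x @[n --> \oo]
      --> partial s (fun y => - N y) x.

End Copulas.

(* The value c is taken outside ]0, 1[. *)
Definition quantile {R : realType} (F : R -> R) (c q : R) : R :=
  if 0 < q < 1 then inf [set t | q <= F t] else c.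

Section Maxima.
Context {R : realType} {d : nat} {dO : measure_display} {Om : measurableType dO}.

(* Componentwise maximum of the vectors of indices 0, ..., n - 1, for n > 0;
   since the base value is the first term, it does not alter the maximum. *)
Definition maxima {P : probability Om R} (Xs : nat -> 'I_d -> {RV P >-> R})
    (n : nat) (w : Om) : 'rV[R]_d :=
  \row_j \big[Num.max/Xs 0%N j w]_(i < n) Xs i j w.

Definition quantile_vector {Q : probability Om R} (F : 'I_d -> R -> R)
    (c : 'I_d -> R) (eta : 'I_d -> {RV Q >-> R}) (n : nat) (w : Om) : 'rV[R]_d :=
  \row_j quantile (F j) (c j) (1 + n%:R^-1 * eta j w).

End Maxima.

(* Main.v *)
(* The law mu_n of the rescaled maxima need not have a density, and the mixed
   partial derivative of its distribution function H_n is only known to exist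
   at each point for n large.  Form the difference quotients of H_n over cells
   of dyadic grids, one mesh per coordinate, and let the meshes go to 0 one
   after the other: the iterated lower limit f_n is the mixed partial
   derivative wherever that one exists, and iterating Fatou's lemma gives
   f_n dx <= mu_n.  The limit law nu has a mixed partial derivative g at every
   point of the open negative orthant; there a martingale argument, one
   coordinate at a time, improves the inequality to nu = g dx.  Since f_n -> g
   pointwise, the common part min(f_n, g) dx of mu_n and nu has mass tending to
   1 by dominated convergence, which bounds the total variation distance
   (Scheffe).  Pointwise convergence of f_n is the chain rule of Faa di Bruno
   for H_n = (1 + u_n / n)^n, where u_n(x) = n (C(1 + x/n) - 1).  Finally
   q <= F(t) iff F^-1(q) <= t, so the maxima of X have the law of the image of
   mu_n under the same map that produces the quantile vector from nu. *)

Require Import Defs.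
From HB Require Import structures.
From mathcomp Require Import all_boot all_order all_algebra finmap.
From mathcomp Require Import all_classical all_reals all_analysis measurable_realfun.
From mathcomp Require Import ring lra.

Set Implicit Arguments.
Unset Strict Implicit.
Unset Printing Implicit Defensive.

Import Order.TTheory GRing.Theory Num.Theory.
Import numFieldNormedType.Exports.

Local Open Scope classical_set_scope.
Local Open Scope ring_scope.

(** * Densities of measures along a filtration *)

(** An iterated partial derivative that merely exists at a point says nothing about quotients whose
    meshes shrink together; this is why the meshes go to 0 in the order of differentiation and why
    every limit below is iterated. A derivative of a distribution function does not see a singular
    part of the measure. What excludes such a part for nu is that the quotients have a finite limit
    at every point, not merely at almost every one: the part of nu carried by the set where they
    stay below M is absolutely continuous, and these sets exhaust the box. For mu_n at fixed n
    nothing of the kind is known everywhere, but a common part only has to lie below both measures,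
    so Fatou's inequality is enough there. The laws mu_n are built from the copula, on product
    spaces of their own, since the margins of X may have atoms; only the quantile map links them
    with X. The comparison takes place on boxes whose closure lies in the open orthant and which
    carry almost all of nu. *)

Section density_measure.
Context d (T : measurableType d) (R : realType).
Variables (lam : {measure set T -> \bar R}) (f : T -> \bar R).
Hypotheses (mf : measurable_fun setT f) (f0 : forall x, (0 <= f x)%E).

(** The two proofs are arguments of the definition so that the measure structure can be attached to
    it as a canonical instance. *)
Definition density_measure of measurable_fun setT f
  & (forall x, (0 <= f x)%E) := fun A => (\int[lam]_(x in A) f x)%E.

Let density0 : density_measure mf f0 set0 = 0%E.
Proof. by rewrite /density_measure integral_set0. Qed.

Let density_ge0 A : (0 <= density_measure mf f0 A)%E.
Proof. by apply: integral_ge0. Qed.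

Let density_additive : semi_sigma_additive (density_measure mf f0).
Proof. exact: semi_sigma_additive_nng_induced. Qed.

HB.instance Definition _ := isMeasure.Build _ _ _ (density_measure mf f0)
  density0 density_ge0 density_additive.

End density_measure.

Section approximation.
Context d (T : measurableType d) (R : realType).
Local Open Scope ereal_scope.

(** The sets with this property form a Dynkin system containing the algebra [G]. For a countable
    disjoint union, continuity from below discards a tail of small mass, and the remaining finite
    union is treated with the closure under unions. *)
Lemma algebra_approximation (m : {measure set T -> \bar R}) (G : set (set T)) :
  m setT < +oo -> @measurable _ T = <<s G >> -> setI_closed G ->
  G setT -> setC_closed G ->
  forall A, measurable A -> forall e : R, (0 < e)%R ->
    exists2 A', G A' & m (A `\` A') <= e%:E /\ m (A' `\` A) <= e%:E.
Proof.
move=> moo GE GI GT GC A mA.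
have Gm B : G B -> measurable B by move=> GB; rewrite GE; exact: sub_sigma_algebra.
have GU B C : G B -> G C -> G (B `|` C).
  move=> GB GC'; rewrite -(setCK (B `|` C)) setCU; apply: (GC).
  by apply: GI; apply: GC.
have mfin B : measurable B -> m B < +oo.
  by move=> mB; apply: le_lt_trans moo; apply: le_measure; rewrite ?inE.
pose P B := forall e : R, (0 < e)%R ->
    exists2 A', G A' & m (B `\` A') <= e%:E /\ m (A' `\` B) <= e%:E.
have PG B : G B -> P B.
  by move=> GB e e0; exists B => //; rewrite setDv measure0 lee_fin ltW.
have PU B C : measurable B -> measurable C -> P B -> P C -> P (B `|` C).
  move=> mB mC PB PC e e0; have e20 : (0 < e / 2)%R by rewrite divr_gt0.
  have [B' GB' [h1 h2]] := PB _ e20; have [C' GC' [h3 h4]] := PC _ e20.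
  exists (B' `|` C'); first exact: GU.
  have mB' := Gm _ GB'; have mC' := Gm _ GC'.
  rewrite [X in X%:E]splitr EFinD; split.
    apply: le_trans (leeD h1 h3).
    apply: (le_trans _ (measureU2 _ _ _)); rewrite ?inE; try exact: measurableD.
    apply: le_measure; rewrite ?inE.
    - by apply: measurableD; exact: measurableU.
    - by apply: measurableU; exact: measurableD.
    - by move=> x [[Bx|Cx] /not_orP[nB nC]]; [left|right].
  apply: le_trans (leeD h2 h4).
  apply: (le_trans _ (measureU2 _ _ _)); rewrite ?inE; try exact: measurableD.
  apply: le_measure; rewrite ?inE.
  - by apply: measurableD; exact: measurableU.
  - by apply: measurableU; exact: measurableD.
  - by move=> x [[Bx|Cx] /not_orP[nB nC]]; [left|right].
suff : P A by [].
move: mA; rewrite GE; move: A; apply: (dynkin_induction GE GI) => //.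
- exact: PG.
- move=> S mS PS e e0; have [A' GA' [h1 h2]] := PS e e0.
  by exists (~` A'); [exact: GC|rewrite !setDE !setCK !(setIC (~` _)) -!setDE].
- move=> F mF tF PF e e0; have e20 : (0 < e / 2)%R by rewrite divr_gt0.
  pose H n := \big[setU/set0]_(i < n) F i.
  have mH n : measurable (H n) by apply: bigsetU_measurable.
  have PH n : P (H n).
    elim: n => [|n IH]; rewrite /H ?big_ord0 ?big_ord_recr//=.
      by apply: PG; rewrite -(setCK set0) setC0; apply: GC.
    by apply: PU => //; exact: mH.
  have mcup : measurable (\bigcup_k F k) by apply: bigcup_measurable.
  have cvgH : m (H n) @[n --> \oo] --> m (\bigcup_k F k).
    rewrite -[X in m X](bigcup_bigsetU_bigcup F).
    have := @nondecreasing_cvg_mu _ _ _ m (fun n => H n.+1).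
    rewrite -(cvg_shiftS (fun n => m (H n))); apply => //.
    + by rewrite bigcup_bigsetU_bigcup.
    + by apply/nondecreasing_seqP => n; rewrite subsetEset /H => x Hx; rewrite big_ord_recr; left.
  have /fine_cvgP[_ /cvgrPdist_lt/(_ _ e20)[n _ /(_ n (leqnn n))/=]] :
    m (H n) @[n --> \oo] --> (fine (m (\bigcup_k F k)))%:E.
    by rewrite fineK// ge0_fin_numE// mfin.
  have HF : H n `<=` \bigcup_k F k.
    by rewrite /H -bigcup_mkord => x [k _ Fx]; exists k.
  rewrite -fineB ?ge0_fin_numE ?mfin// => hn.
  have hD : m (\bigcup_k F k `\` H n) < (e / 2)%:E.
    rewrite measureD ?mfin//= setIidr//.
    have fin : m (\bigcup_k F k) - m (H n) \is a fin_num.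
      by rewrite fin_numB !ge0_fin_numE ?mfin.
    by rewrite -(fineK fin) lte_fin (le_lt_trans (ler_norm _)).
  have [A' GA' [h1 h2]] := PH n _ e20; have mA' := Gm _ GA'.
  exists A' => //; split; last first.
    apply: le_trans (le_trans h2 _); last by rewrite lee_fin ler_pdivrMr// ler_pMr// ler1n.
    apply: le_measure; rewrite ?inE; [exact: measurableD|exact: measurableD|].
    by move=> x [A'x nF]; split => // /HF.
  rewrite [X in X%:E]splitr EFinD; apply: le_trans (leeD (ltW hD) h1).
  apply: (le_trans _ (measureU2 _ _ _)); rewrite ?inE; try exact: measurableD.
  apply: le_measure; rewrite ?inE; [exact: measurableD|apply: measurableU; exact: measurableD|].
  by move=> x [Fx nA']; have [Hx|nHx] := pselect (H n x); [right|left].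
Qed.

(** An inequality of measures does not pass to complements, so a Dynkin argument on the inequality
    itself fails. Approximation is used instead, for the sum of the two measures, so that one set
    [A'] serves both. *)
Lemma le_measure_algebra (rho mu : {measure set T -> \bar R}) (G : set (set T)) :
  rho setT < +oo -> mu setT < +oo ->
  @measurable _ T = <<s G >> -> setI_closed G ->
  G setT -> setC_closed G ->
  (forall A, G A -> rho A <= mu A) ->
  forall A, measurable A -> rho A <= mu A.
Proof.
move=> roo moo GE GI GT GC le A mA.
have Gm B : G B -> measurable B by move=> GB; rewrite GE; exact: sub_sigma_algebra.
apply/lee_addgt0Pr => e e0; have e20 : (0 < e / 2)%R by rewrite divr_gt0.
pose m : {measure set T -> \bar R} := measure_add rho mu.
have mE S : m S = rho S + mu S by exact: measure_addE.
have moo' : m setT < +oo by rewrite mE lte_add_pinfty.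
have [A' GA' []] := @algebra_approximation m G moo' GE GI GT GC _ mA _ e20.
rewrite !mE => h1 h2; have mA' := Gm _ GA'.
have h3 : rho (A `\` A') <= (e / 2)%:E by apply: le_trans h1; rewrite leeDl.
have h4 : mu (A' `\` A) <= (e / 2)%:E by apply: le_trans h2; rewrite leeDr.
apply: (@le_trans _ _ (rho A' + (e / 2)%:E)).
  apply: le_trans (leeD (lexx _) h3).
  apply: (le_trans _ (measureU2 _ _ _)); rewrite ?inE//; try exact: measurableD.
  apply: le_measure; rewrite ?inE//; first by apply: measurableU => //; exact: measurableD.
  by move=> x Ax; have [?|?] := pselect (A' x); [left|right].
rewrite [in leRHS](splitr e) EFinD addeA leeD2r//.
apply: (le_trans (le _ GA')); apply: le_trans (leeD (lexx _) h4).
apply: (le_trans _ (measureU2 _ _ _)); rewrite ?inE//; try exact: measurableD.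
apply: le_measure; rewrite ?inE//; first by apply: measurableU => //; exact: measurableD.
by move=> x Ax; have [?|?] := pselect (A x); [left|right].
Qed.

End approximation.

Section density_on.
Context d (T : measurableType d) (R : realType).
Variables (lam nu : {measure set T -> \bar R}) (B : set T).
Hypothesis mB : measurable B.
Local Open Scope ereal_scope.

(* nu has density phi with respect to lam on the traces on B of the sets of the
   sigma-algebra generated by the map r. *)
Definition density_on (r : T -> T) (phi : T -> R) : Prop :=
  measurable_fun B phi /\
  forall A, measurable A ->
    nu (B `&` r @^-1` A) = \int[lam]_(x in B `&` r @^-1` A) (phi x)%:E.

(* The idea: the set where phi_ 0, ..., phi_ k are at most M belongs to the
   k-th sigma-algebra, so nu can be computed on it; there dominated convergence
   applies as k grows, and these sets exhaust B as M grows because convergent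
   sequences are bounded. *)
Lemma density_on_limit (G : set (set T)) (r_ : nat -> T -> T) (r : T -> T)
    (phi_ : nat -> T -> R) (phi : T -> R) :
  lam B < +oo -> nu B < +oo ->
  @measurable _ T = <<s G >> -> setI_closed G ->
  measurable_fun setT r ->
  (forall k x, B x -> B (r_ k x)) ->
  (forall j k x, (j <= k)%N -> B x -> phi_ j (r_ k x) = phi_ j x) ->
  (forall A, G A -> exists k0, forall k, (k0 <= k)%N ->
     r @^-1` A = r_ k @^-1` A) ->
  (forall k x, B x -> (0 <= phi_ k x)%R) ->
  (forall x, B x -> phi_ k x @[k --> \oo] --> phi x) ->
  (forall k, density_on (r_ k) (phi_ k)) ->
  density_on r phi.
Proof.
move=> lamoo nuoo GE GI mr rB phir Gr phi0 phi_cvg hd.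
have mphi : measurable_fun B phi.
  by apply: (measurable_fun_cvg (h := phi_)) => // k; case: (hd k).
have phi_ge0 x : B x -> (0 <= phi x)%R.
  move=> Bx; rewrite -(cvg_lim _ (phi_cvg x Bx))//.
  apply: (@limr_ge _ _ _ _ _ (phi_ ^~ x)); last by apply: nearW => k; exact: phi0.
  by apply/cvg_ex; exists (phi x); exact: phi_cvg.
have Gm A : G A -> measurable A by move=> GA; rewrite GE; exact: sub_sigma_algebra.
have mrA A : measurable A -> measurable (B `&` r @^-1` A).
  by move=> mA; apply: measurableI => //; rewrite -[X in measurable X]setTI; exact: mr.
pose f := (EFin \o phi) \_ B.
have mf : measurable_fun setT f.
  by apply/(measurable_restrictT _ mB); apply/measurable_EFinP.
have f0 x : 0 <= f x.
  by rewrite /f patchE; case: ifPn => // /[!inE] /phi_ge0; rewrite lee_fin.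
pose m : {measure set T -> \bar R} := density_measure lam mf f0.
have mE A : m A = \int[lam]_(x in A `&` B) (phi x)%:E.
  by rewrite integral_mkcondr.
have mEB A : A `<=` B -> m A = \int[lam]_(x in A) (phi x)%:E.
  by move=> AB; rewrite mE setIidl.
(* The event that the sequence has not exceeded M up to time k, as in stopping a martingale at its
   first passage above M. *)
pose E M k := B `&` \bigcap_(j in [set j | (j <= k)%N])
  (B `&` phi_ j @^-1` [set y | (y <= M%:R)%R]).
have mE1 M k : measurable (E M k).
  apply: measurableI => //; apply: bigcap_measurable; first by exists k => /=.
  move=> j _; have := (hd j).1 mB; apply.
  have -> : [set y : R | (y <= M%:R)%R] = `]-oo, M%:R]%classic.
    by apply/seteqP; split => y /=; rewrite in_itv.
  exact: measurable_itv.
have Enonincr M : {homo E M : k l / (k <= l)%N >-> (l <= k)%O}.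
  move=> k l kl; rewrite subsetEset => x [Bx Ex]; split => // j /= jk.
  by apply: Ex => /=; exact: leq_trans jk kl.
have key A : measurable A -> (exists k0, forall k, (k0 <= k)%N ->
     r @^-1` A = r_ k @^-1` A) -> nu (B `&` r @^-1` A) = m (B `&` r @^-1` A).
  move=> mA [k0 hk0].
  set S := B `&` r @^-1` A; have mS : measurable S := mrA _ mA.
  pose EM M := \bigcap_k E M k.
  have mEM M : measurable (EM M) by apply: bigcapT_measurable.
  have step k M : (k0 <= k)%N -> nu (S `&` E M k) =
      \int[lam]_(x in S `&` E M k) (phi_ k x)%:E.
    (* By [phir] the event [E M k] is unchanged by [r_ k], hence the set is a trace to which the
       density at level k applies. *)
    move=> k0k; have -> : S `&` E M k = B `&` r_ k @^-1` (A `&` E M k).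
      have -> : S = B `&` r_ k @^-1` A by rewrite /S (hk0 _ k0k).
      apply/seteqP; split => x [].
        move=> [Bx Ax] [_ Ex]; split => //; split => //; split; first exact: rB.
        by move=> j jk; split; [exact: rB|rewrite /= phir//; case: (Ex j jk)].
      move=> Bx [Ax [_ Ex]]; split => //; split => // j jk; split => //.
      by case: (Ex j jk) => _; rewrite /= phir.
    by apply: (hd k).2; apply: measurableI.
  have limM M : nu (S `&` EM M) = m (S `&` EM M).
    have SE : S `&` EM M = \bigcap_k (S `&` E M k).
      by rewrite /EM bigcapIr//; exists 0%N.
    have mSE k : measurable (S `&` E M k) by exact: measurableI.
    have h1 : nu (S `&` E M k) @[k --> \oo] --> nu (S `&` EM M).
      rewrite SE; apply: nonincreasing_cvg_mu => //.
      - by apply: le_lt_trans nuoo; apply: le_measure; rewrite ?inE// => x [[]].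
      - exact: bigcapT_measurable.
      - by move=> k l kl; rewrite subsetEset; apply: setIS; rewrite -subsetEset; exact: Enonincr.
    have h2 : \int[lam]_(x in S `&` E M k) (phi_ k x)%:E @[k --> \oo] -->
        \int[lam]_(x in S `&` EM M) (phi x)%:E.
      rewrite integral_mkcondr; under eq_cvg do rewrite integral_mkcondr.
      have SB : S `<=` B by exact: subIsetl.
      have := @dominated_convergence _ _ _ lam S mS
        (fun k => (EFin \o phi_ k) \_ (E M k)) ((EFin \o phi) \_ (EM M)) (cst M%:R%:E).
      case => //.
      - move=> k; apply: (measurable_restrict (EFin \o phi_ k) (mE1 M k) mS).1; apply/measurable_EFinP.
        by apply: measurable_funS (hd k).1 => // x [/SB].
      - apply: (measurable_restrict (EFin \o phi) (mEM M) mS).1; apply/measurable_EFinP.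
        by apply: measurable_funS mphi => // x [/SB].
      - apply: aeW => x Sx; have Bx := SB _ Sx.
        have [EMx|nEMx] := pselect (EM M x).
          rewrite patchE mem_set//=.
          have h k : ((EFin \o phi_ k) \_ (E M k)) x = (phi_ k x)%:E.
            by rewrite patchE mem_set//; exact: (EMx k I).
          under eq_cvg do rewrite h.
          by apply/cvg_EFin; [exact: nearW|exact: phi_cvg].
        rewrite patchE memNset//=.
        have [k nEk] : exists k, ~ E M k x by apply/existsNP => h; apply: nEMx.
        apply: cvg_near_cst; exists k => // l /= kl.
        have nEl : ~ E M l x.
          by move=> El; apply: nEk; have := Enonincr M _ _ kl; rewrite subsetEset; apply.
        by rewrite patchE memNset.
      - apply: (@integrableS _ _ _ _ B) => //.
        apply/integrableP; split => //; rewrite /=.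
        by rewrite normr_nat integral_cst// lte_mul_pinfty// lee_fin.
      - apply: aeW => x k Sx; rewrite patchE; case: ifPn => /=; last first.
          by rewrite normr0 lee_fin.
        rewrite inE => -[Bx Ex]; rewrite ger0_norm ?lee_fin ?phi0//.
        by have [] := Ex k (leqnn k).
    rewrite mEB; last by move=> x [[]].
    apply: (cvg_unique _ h1) => //; apply: cvg_trans h2.
    apply: near_eq_cvg; exists k0 => // k /= k0k; exact/esym/step.
  have cupE : S = \bigcup_M (S `&` EM M).
    rewrite -setI_bigcupr; apply/esym/setIidl => x [Bx _].
    have : cvgn (fun k => phi_ k x) by apply/cvg_ex; exists (phi x); exact: phi_cvg.
    move/cvg_seq_bounded/pinfty_ex_gt0 => [C C0 hC].
    exists (Num.bound C) => // k _; split => // j _; split => //=.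
    apply: (le_trans (ler_norm _)); apply: (le_trans (hC j I)).
    by apply/ltW/archi_boundP/ltW.
  have ndS : nondecreasing_seq (fun M => S `&` EM M).
    move=> M M' MM'; rewrite subsetEset; apply: setIS => x Ex k _.
    have [Bx {}Ex] := Ex k I; split => // j /Ex[_ /= h]; split => //=.
    by apply: (le_trans h); rewrite ler_nat.
  have mSEM M : measurable (S `&` EM M) by exact: measurableI.
  have h (n : {measure set T -> \bar R}) : n (S `&` EM M) @[M --> \oo] --> n S.
    rewrite [X in n X]cupE; apply: (nondecreasing_cvg_mu mSEM _ ndS).
    exact: bigcup_measurable.
  have := h nu; under eq_cvg do rewrite limM; move=> h'.
  exact: (cvg_unique _ h' (h m)).
split => // A mA; rewrite -mEB; last exact: subIsetl.
(* Integrability of [phi] is a conclusion here: the total mass of its integral is that of [nu] by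
   [key]. Finiteness is what allows complements in the Dynkin induction. *)
have moo : m B < +oo.
  have := key setT measurableT; rewrite preimage_setT setIT => <-//.
  by exists 0%N => k _; rewrite preimage_setT.
have mBE : nu B = m B.
  have := key setT measurableT; rewrite preimage_setT setIT => ->//.
  by exists 0%N => k _; rewrite preimage_setT.
move: mA; rewrite GE; move: A; apply: (dynkin_induction GE GI) => //.
- by rewrite preimage_setT setIT.
- by move=> A GA; apply: key; [exact: Gm|exact: Gr].
- move=> A mA hA; rewrite preimage_setC -setDE.
  have -> : B `\` r @^-1` A = B `\` (B `&` r @^-1` A) by rewrite setDIr setDv set0U.
  rewrite !measureD//= ?setIA ?setIid; try exact: mrA.
  by rewrite mBE hA.
- move=> F mF tF hF; rewrite preimage_bigcup setI_bigcupr.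
  rewrite !measure_bigcup//; try by [move=> i _; exact: mrA].
  + by apply: eq_eseriesr => i _; exact: hF.
  + by apply: trivIset_setIl => i j _ _ [x [Fi Fj]]; apply: tF => //; exists (r x).
  + by apply: trivIset_setIl => i j _ _ [x [Fi Fj]]; apply: tF => //; exists (r x).
Qed.

End density_on.

Section density_on_partition.
Context d (T : measurableType d) (R : realType).
Variables (lam nu : {measure set T -> \bar R}) (B : set T).
Hypothesis mB : measurable B.
Local Open Scope ereal_scope.

(** The elementary case, where the colouring [c] cuts [B] into finitely many pieces on which
    everything is constant: masses only have to be compared piece by piece. *)
Lemma density_on_partition (J : finType) (c : T -> J) (r : T -> T)
    (phi : T -> R) :
  (forall x, B x -> measurable (B `&` c @^-1` [set c x])) ->
  (forall x y, B x -> B y -> c x = c y -> r x = r y /\ phi x = phi y) ->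
  (forall x, B x -> (0 <= phi x)%R) ->
  (forall x, B x -> (phi x)%:E * lam (B `&` c @^-1` [set c x]) =
                    nu (B `&` c @^-1` [set c x])) ->
  density_on lam nu B r phi.
Proof.
move=> mc cstf phi_ge0 hphi.
(* Unions of pieces; finiteness of [J] makes them all measurable, in particular the level sets of
   [phi] and the traces of [r]. *)
pose sat S := S `<=` B /\ forall x y, S x -> B y -> c x = c y -> S y.
have fiber S j : sat S -> S `&` c @^-1` [set j] = set0 \/
    exists x, [/\ S x, c x = j & S `&` c @^-1` [set j] = B `&` c @^-1` [set c x]].
  move=> [SB Ssat]; have [->|/set0P[x [Sx cx]]] := eqVneq (S `&` c @^-1` [set j]) set0.
    by left.
  right; exists x; split => //; apply/seteqP; split => y [].
    by move=> Sy cy; split; [exact: SB|rewrite /= cx cy].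
  by move=> By /= cy; split; [exact: (Ssat x)|rewrite /= cy].
have cover S : S = \bigcup_(j in [set: J]) (S `&` c @^-1` [set j]).
  by apply/seteqP; split => [x Sx|x [j _ []]//]; exists (c x).
have mf S j : sat S -> measurable (S `&` c @^-1` [set j]).
  by move=> satS; have [->//|[x [Sx _ ->]]] := fiber _ j satS; apply: mc; exact: satS.1.
have mS S : sat S -> measurable S.
  move=> satS; rewrite (cover S); apply: fin_bigcup_measurable => [|j _].
    exact: finite_finset.
  exact: mf.
have mphi : measurable_fun B phi.
  move=> _ Y mY; apply: mS; split; first exact: subIsetl.
  by move=> x y [Bx Yx] By /(cstf _ _ Bx By)[_ e]; split => //; rewrite /= -e.
split => // A mA.
pose f := (EFin \o phi) \_ B.
have mff : measurable_fun setT f.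
  by apply/(measurable_restrictT _ mB); apply/measurable_EFinP.
have f0 x : 0 <= f x.
  by rewrite /f patchE; case: ifPn => // /[!inE] /phi_ge0; rewrite lee_fin.
pose m : {measure set T -> \bar R} := density_measure lam mff f0.
have mE S : S `<=` B -> m S = \int[lam]_(x in S) (phi x)%:E.
  by move=> SB; rewrite -[in RHS](setIidl SB) integral_mkcondr.
set S := B `&` r @^-1` A; rewrite -mE; last exact: subIsetl.
have satS : sat S.
  split; first exact: subIsetl.
  by move=> x y [Bx Ax] By /(cstf _ _ Bx By)[e _]; split => //; rewrite /= -e.
have tS : trivIset [set: J] (fun j => S `&` c @^-1` [set j]).
  by move=> i j _ _ [x [[_ <-] [_ <-]]].
have fiberE j : nu (S `&` c @^-1` [set j]) = m (S `&` c @^-1` [set j]).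
  have [->|[x [Sx _ ->]]] := fiber S j satS; first by rewrite !measure0.
  have Bx : B x by case: Sx.
  rewrite mE; last exact: subIsetl.
  rewrite -hphi// (eq_integral (cst (phi x)%:E)); last first.
    by move=> y; rewrite inE => -[By /= e]; have [_ ->] := cstf _ _ By Bx e.
  by rewrite integral_cst//; exact: mc.
rewrite (cover S) !measure_fin_bigcup//; try exact: finite_finset.
- by apply: eq_fsbigr => j _; exact: fiberE.
- by move=> j _; exact: mf.
- by move=> j _; exact: mf.
Qed.

End density_on_partition.

(** * Iterated limits and Fatou's lemma *)

Section iterated_liminf.
Context (R : realType).
Local Open Scope ereal_scope.

(** Lower limits always exist, so this is a measurable function of a parameter also at points where
    the derivative fails to exist. *)
Fixpoint itliminf n (F : seq nat -> \bar R) : \bar R :=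
  if n is n'.+1 then limn_einf (fun k => itliminf n' (fun ks => F (k :: ks)))
  else F [::].

(* The limit along the last entry of the list is taken first. *)
Fixpoint itlim n (F : seq nat -> R) (l : R) : Prop :=
  if n is n'.+1 then
    exists2 u : nat -> R, (\forall k \near \oo, itlim n' (fun ks => F (k :: ks)) (u k))
      & u k @[k --> \oo] --> l
  else F [::] = l.

Lemma itlim_itliminf n F l : itlim n F l -> itliminf n (EFin \o F) = l%:E.
Proof.
elim: n F l => [F l /= ->//|n IH F l [u hu ul]].
have : itliminf n (EFin \o (fun ks => F (k :: ks))) @[k --> \oo] --> l%:E.
  have : (u k)%:E @[k --> \oo] --> l%:E by apply/cvg_EFin => //; exact: nearW.
  apply: cvg_trans; apply: near_eq_cvg.
  by near=> k; apply/esym/IH; near: k.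
by move=> /cvg_limn_einf_sup[].
Unshelve. all: by end_near. Qed.

Lemma itlimB n F F' l l' : itlim n F l -> itlim n F' l' ->
  itlim n (fun ks => F ks - F' ks)%R (l - l')%R.
Proof.
elim: n F F' l l' => [F F' l l' /= -> ->//|n IH F F' l l' [u hu ul] [v hv vl]].
exists (fun k => u k - v k)%R; last exact: cvgB.
by near=> k; apply: IH; near: k.
Unshelve. all: by end_near. Qed.

Lemma itlimZ n (a : R) F l : itlim n F l -> itlim n (fun ks => a * F ks)%R (a * l)%R.
Proof.
elim: n F l => [F l /= ->//|n IH F l [u hu ul]].
exists (fun k => a * u k)%R; last by apply: cvgM => //; exact: cvg_cst.
by near=> k; apply: IH; near: k.
Unshelve. all: by end_near. Qed.

Lemma limn_einf_ge0 (u : nat -> \bar R) : (forall k, 0 <= u k) -> 0 <= limn_einf u.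
Proof.
move=> u0; rewrite limn_einf_lim; apply: lime_ge; first exact: is_cvg_einfs.
by apply: nearW => k; apply: le_ereal_inf_tmp => _ [j _ <-].
Qed.

Lemma limn_einf_le (u : nat -> \bar R) (c : \bar R) :
  (\forall k \near \oo, u k <= c) -> limn_einf u <= c.
Proof.
move=> [k0 _ uc]; rewrite limn_einf_lim; apply: lime_le; first exact: is_cvg_einfs.
apply: nearW => k; apply: (@le_trans _ _ (u (maxn k k0))).
  by apply: ereal_inf_lbound; exists (maxn k k0) => //=; exact: leq_maxl.
by apply: uc => /=; exact: leq_maxr.
Qed.

Lemma itliminf_ge0 n F : (forall ks, size ks = n -> 0 <= F ks) -> 0 <= itliminf n F.
Proof.
elim: n F => [|n IH] F F0 /=; first exact: F0.
by apply: limn_einf_ge0 => k; apply: IH => ks sks; apply: F0; rewrite /= sks.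
Qed.

Lemma measurable_itliminf d (T : measurableType d) (D : set T) n
    (F : seq nat -> T -> \bar R) :
  (forall ks, size ks = n -> measurable_fun D (F ks)) ->
  measurable_fun D (fun x => itliminf n (F ^~ x)).
Proof.
elim: n F => [|n IH] F mF /=; first exact: mF.
rewrite /limn_einf; apply: measurableT_comp => //.
apply: measurable_fun_limn_esup => k; apply: measurableT_comp => //.
by apply: (IH (fun ks => F (k :: ks))) => ks sks; apply: mF; rewrite /= sks.
Qed.

(** One application of Fatou's lemma per limit. The bound is asked for only from [k0] on, because a
    set of the grid algebra is a union of cells only from some level on. *)
Lemma itliminf_fatou d (T : measurableType d) (lam : {measure set T -> \bar R})
    (D : set T) (c : \bar R) (k0 : nat) n (F : seq nat -> T -> \bar R) :
  measurable D -> (forall ks, size ks = n -> measurable_fun D (F ks)) ->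
  (forall ks x, size ks = n -> D x -> 0 <= F ks x) ->
  (forall ks, size ks = n -> all (leq k0) ks -> \int[lam]_(x in D) F ks x <= c) ->
  \int[lam]_(x in D) itliminf n (F ^~ x) <= c.
Proof.
move=> mD; elim: n F => [|n IH] F mF F0 Fc /=; first exact: Fc.
apply: le_trans (fatou _ _ _ _) _ => //.
- move=> k; apply: (@measurable_itliminf _ _ _ n (fun ks => F (k :: ks))) => ks sks.
  by apply: mF; rewrite /= sks.
- by move=> k x Dx; apply: itliminf_ge0 => ks sks; apply: F0; rewrite /= ?sks.
- apply: limn_einf_le; exists k0 => // k /= k0k.
  apply: (IH (fun ks => F (k :: ks))) => //.
  - by move=> ks sks; apply: mF; rewrite /= sks.
  - by move=> ks x sks; apply: F0; rewrite /= sks.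
  by move=> ks sks kks; apply: Fc; rewrite /= ?sks ?k0k.
Qed.

End iterated_liminf.

(** * Difference quotients over dyadic cells *)

Section grid.
Context (R : realType) (b L : R).
Hypothesis L0 : 0 < L.
Implicit Types (k j : nat) (t s : R).

(* The cells of level k are the intervals ]b - (j + 1) L / 2 ^ k, b - j L / 2 ^ k]
   for j in Z; cell_lo k t and cell_up k t bound the one containing t. *)
Definition mesh k : R := L / 2 ^+ k.
(** Counting downwards from [b] makes the floor close the cells on the right, as increments of
    distribution functions require. *)
Definition cell_index k t : int := Num.floor ((b - t) / mesh k).
Definition cell_up k t : R := b - mesh k * (cell_index k t)%:~R.
Definition cell_lo k t : R := cell_up k t - mesh k.

Lemma mesh_gt0 k : 0 < mesh k.
Proof. by rewrite divr_gt0// exprn_gt0. Qed.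

Lemma mesh_neq0 k : mesh k != 0.
Proof. by rewrite gt_eqF// mesh_gt0. Qed.

Lemma cell_itv k t : cell_lo k t < t <= cell_up k t.
Proof.
have /andP[] := floor_itv ((b - t) / mesh k).
rewrite -/(cell_index k t) ler_pdivlMr ?mesh_gt0// ltr_pdivrMr ?mesh_gt0//.
by rewrite /cell_lo /cell_up intrD; move=> h1 h2; apply/andP; split; lra.
Qed.

Lemma cell_up_eq k t s : cell_lo k t < s <= cell_up k t -> cell_up k s = cell_up k t.
Proof.
rewrite /cell_lo /cell_up => /andP[h1 h2]; congr (_ - _ * _%:~R).
apply: floor_def; rewrite ler_pdivlMr ?mesh_gt0// ltr_pdivrMr ?mesh_gt0//.
by rewrite intrD; apply/andP; split; lra.
Qed.

Lemma cell_lo_eq k t s : cell_up k s = cell_up k t -> cell_lo k s = cell_lo k t.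
Proof. by rewrite /cell_lo => ->. Qed.

Lemma cell_eqP k t s : (cell_lo k t < s <= cell_up k t) = (cell_up k s == cell_up k t).
Proof.
apply/idP/eqP; first exact: cell_up_eq.
by move=> e; rewrite -(cell_lo_eq e) -e cell_itv.
Qed.

Lemma mesh_le j k : (j <= k)%N -> mesh j = mesh k * 2 ^+ (k - j).
Proof.
move=> jk; rewrite /mesh -[in 2 ^+ k](subnK jk) exprD.
by field; rewrite !expf_neq0.
Qed.

(** Nesting of the dyadic grids: a cell of level j splits into 2^(k-j) cells of level k, so the
    finer index is at least 2^(k-j) times the coarser one. *)
Lemma cell_up_mono j k t : (j <= k)%N -> cell_up k t <= cell_up j t.
Proof.
move=> jk; rewrite /cell_up lerD2l lerN2 (mesh_le jk) -mulrA ler_pM2l ?mesh_gt0//.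
have -> : 2 ^+ (k - j) * (cell_index j t)%:~R = (2 ^+ (k - j) * cell_index j t)%:~R :> R.
  by rewrite intrM rmorphXn.
rewrite ler_int floor_ge_int intrM.
have /andP[h _] := floor_itv ((b - t) / mesh j).
rewrite ler_pdivlMr ?mesh_gt0// -/(cell_index j t) in h.
rewrite ler_pdivlMr ?mesh_gt0// (le_trans _ h)// le_eqVlt; apply/orP; left; apply/eqP.
by move: (cell_index j t) => c; rewrite (mesh_le jk) rmorphXn/=; ring.
Qed.

(** This identity is what makes the levels a filtration. *)
Lemma cell_up_up j k t : (j <= k)%N -> cell_up j (cell_up k t) = cell_up j t.
Proof.
move=> jk; apply: cell_up_eq; rewrite cell_up_mono// andbT.
by have /andP[h _] := cell_itv j t; have /andP[_ /(lt_le_trans h)] := cell_itv k t.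
Qed.

Lemma cell_up_le k t : t <= b -> cell_up k t <= b.
Proof.
move=> tb; rewrite /cell_up gerBl; apply: mulr_ge0; first exact/ltW/mesh_gt0.
by rewrite ler0z floor_ge0 divr_ge0 ?subr_ge0// ltW// mesh_gt0.
Qed.

(** Since L is 2^k meshes, an edge of the box is cut into exactly 2^k cells. Hence there are
    finitely many cells per level, and no cell of the box sticks out below. *)
Lemma cell_index_bound k t : b - L < t <= b ->
  0 <= cell_index k t /\ (cell_index k t)%:~R + 1 <= 2 ^+ k :> R.
Proof.
move=> /andP[h1 h2]; split.
  by rewrite floor_ge0 divr_ge0 ?subr_ge0// ltW// mesh_gt0.
have -> : 2 ^+ k = (2 ^+ k : int)%:~R :> R by rewrite rmorphXn.
rewrite -[X in _ + X]/(1%:~R) -intrD ler_int lezD1 -(ltr_int R).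
have /andP[h _] := floor_itv ((b - t) / mesh k).
rewrite (le_lt_trans h)// ltr_pdivrMr ?mesh_gt0// rmorphXn /mesh.
have -> : (1 *~ 2) ^+ k * (L / 2 ^+ k) = L.
  by rewrite mulrCA divff ?mulr1// expf_neq0.
by lra.
Qed.

Lemma cell_lo_ge k t : b - L < t <= b -> b - L <= cell_lo k t.
Proof.
move=> /(cell_index_bound k)[_ h]; rewrite /cell_lo /cell_up.
have e : mesh k * 2 ^+ k = L by rewrite divfK// expf_neq0.
have : mesh k * ((cell_index k t)%:~R + 1) <= mesh k * 2 ^+ k.
  by rewrite ler_pM2l// mesh_gt0.
by rewrite e; lra.
Qed.

Lemma mesh_cvg0 : mesh k @[k --> \oo] --> (0 : R).
Proof.
have := @cvg_geometric R L 2^-1; rewrite ger0_norm// invf_lt1// ltr1n => /(_ isT).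
by apply: cvg_trans; apply: near_eq_cvg; apply: nearW => k; rewrite /= exprVn.
Qed.

Lemma cell_up_cvg t : cell_up k t @[k --> \oo] --> t.
Proof.
have h : t + mesh k @[k --> \oo] --> t.
  by rewrite -[X in _ --> X]addr0; apply: cvgD; [exact: cvg_cst|exact: mesh_cvg0].
apply: (squeeze_cvgr _ (cvg_cst t) h); apply: nearW => k.
by have := cell_itv k t; rewrite /cell_lo => /andP[h1 h2]; apply/andP; split; lra.
Qed.

Lemma cell_up_nondecreasing k : {homo cell_up k : t s / t <= s}.
Proof.
move=> t s ts; rewrite /cell_up lerD2l lerN2 ler_pM2l ?mesh_gt0// ler_int.
by apply: le_floor; rewrite ler_pM2r ?invr_gt0 ?mesh_gt0//; lra.
Qed.

Lemma measurable_cell_up k : measurable_fun setT (cell_up k).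
Proof. by apply: nondecreasing_measurable => //; exact: cell_up_nondecreasing. Qed.

End grid.

Section set_coord.
Context (R : realType) (d : nat).
Implicit Types (i j : 'I_d) (x y : 'rV[R]_d) (v w : R).

Definition set_coord i v x : 'rV[R]_d := \row_j (if j == i then v else x 0 j).

Lemma set_coordE i v x j : set_coord i v x 0 j = if j == i then v else x 0 j.
Proof. by rewrite mxE. Qed.

Lemma set_coord_id i v x : set_coord i v x 0 i = v.
Proof. by rewrite mxE eqxx. Qed.

Lemma set_coord_neq i v x j : j != i -> set_coord i v x 0 j = x 0 j.
Proof. by rewrite mxE => /negbTE ->. Qed.

Lemma set_coord_delta i v x : set_coord i v x = (v - x 0 i) *: delta_mx 0 i + x.
Proof.
apply/rowP => j; rewrite !mxE eqxx/=; case: eqP => [->|_]; last by rewrite mulr0 add0r.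
by rewrite mulr1 subrK.
Qed.

End set_coord.

Section difference_quotients.
Context (R : realType) (d : nat) (b L : R).
Hypothesis L0 : 0 < L.
Implicit Types (i j : 'I_d) (s p t : seq 'I_d) (ks : seq nat) (k : nat).
Implicit Types (x y : 'rV[R]_d) (F : 'rV[R]_d -> R).

Local Notation up := (cell_up b L).
Local Notation lo := (cell_lo b L).
Local Notation mesh := (mesh L).

(* The operator of the first coordinate of s is the outermost one, as in partial. *)
Fixpoint diff_quot s ks F x : R :=
  match s, ks with
  | i :: s', k :: ks' =>
      (mesh k)^-1 * (diff_quot s' ks' F (set_coord i (up k (x 0 i)) x) -
                     diff_quot s' ks' F (set_coord i (lo k (x 0 i)) x))
  | _, _ => F x
  end.

(** Only the coordinates in [s] are discretized; those already differentiated stay exact. *)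
Fixpoint round_up s ks x : 'rV[R]_d :=
  match s, ks with
  | i :: s', k :: ks' => set_coord i (up k (x 0 i)) (round_up s' ks' x)
  | _, _ => x
  end.

Lemma round_up_notin s ks x j : j \notin s -> round_up s ks x 0 j = x 0 j.
Proof.
elim: s ks => [|i s IH] [|k ks]//=; rewrite inE negb_or => /andP[ji js].
by rewrite set_coord_neq// IH.
Qed.

Lemma mem_zip_fst (A B : eqType) (u : seq A) (v : seq B) q : q \in zip u v -> q.1 \in u.
Proof.
elim: u v => [|a u IH] [|c v]//=; rewrite !inE => /orP[/eqP -> /=|/IH ->].
  by rewrite eqxx.
by rewrite orbT.
Qed.

Lemma round_up_in s ks x q : uniq s -> q \in zip s ks ->
  round_up s ks x 0 q.1 = up q.2 (x 0 q.1).
Proof.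
elim: s ks => [|i s IH] [|k ks]//= /andP[nis us]; rewrite inE => /orP[/eqP -> /=|qs].
  by rewrite set_coord_id.
rewrite set_coord_neq ?IH//; apply: contraNneq nis => <-.
exact: mem_zip_fst qs.
Qed.

Lemma round_up_rcons s i ks k x : size ks = size s -> i \notin s ->
  round_up (rcons s i) (rcons ks k) x = set_coord i (up k (x 0 i)) (round_up s ks x).
Proof.
elim: s ks => [|j s IH] [|l ks]//= [sz]; rewrite inE negb_or => /andP[ij nis].
rewrite IH//; apply/rowP => m; rewrite !set_coordE.
by case: eqP => // -> ; case: eqP => // e; move: ij; rewrite e eqxx.
Qed.

Lemma diff_quot_eq s ks F x y : uniq s -> size ks = size s ->
  (forall q, q \in zip s ks -> up q.2 (x 0 q.1) = up q.2 (y 0 q.1)) ->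
  (forall j, j \notin s -> x 0 j = y 0 j) ->
  diff_quot s ks F x = diff_quot s ks F y.
Proof.
elim: s ks x y => [|i s IH] [|k ks]//= x y.
  by move=> _ _ _ h; congr F; apply/rowP => j; exact: h.
move=> /andP[nis us] [sz] hz hn.
have e : up k (x 0 i) = up k (y 0 i) by apply: (hz (i, k)); rewrite inE eqxx.
have h v : diff_quot s ks F (set_coord i v x) = diff_quot s ks F (set_coord i v y).
  apply: IH => // [q qs|j js].
    have qi : q.1 != i by apply: contraNneq nis => <-; exact: mem_zip_fst qs.
    by rewrite !set_coord_neq// hz// inE qs orbT.
  rewrite !set_coordE; case: eqP => // /eqP ji.
  by apply: hn; rewrite inE negb_or ji.
by rewrite /cell_lo e !h.
Qed.

(** Isolates the innermost quotient, whose mesh is the first to go to 0. *)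
Lemma diff_quot_rcons s i ks k F x : size ks = size s ->
  diff_quot (rcons s i) (rcons ks k) F x =
  diff_quot s ks (diff_quot [:: i] [:: k] F) x.
Proof. by elim: s ks x => [|j s IH] [|l ks]//= x [sz]; rewrite !IH. Qed.

(** A coordinate already replaced by a cell end may equal [b - L]; one that is still to be
    differenced must be larger, so that the lower end of its cell stays in the closed box. *)
Definition in_box s x :=
  forall j, b - L <= x 0 j <= b /\ (j \in s -> b - L < x 0 j).

Lemma in_box_set_up i s x k : in_box (i :: s) x -> i \notin s ->
  in_box s (set_coord i (up k (x 0 i)) x).
Proof.
move=> hx nis j; rewrite set_coordE; case: eqP => [->|_].
  have [/andP[_ xb] /(_ (mem_head _ _)) xa] := hx i.
  split; last by move=> nis'; rewrite nis' in nis.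
  rewrite cell_up_le// andbT.
  by have /andP[_] := cell_itv b L0 k (x 0 i); apply: le_trans; exact: ltW.
by have [h1 h2] := hx j; split => // js; apply: h2; rewrite inE js orbT.
Qed.

Lemma in_box_set_lo i s x k : in_box (i :: s) x -> i \notin s ->
  in_box s (set_coord i (lo k (x 0 i)) x).
Proof.
move=> hx nis j; rewrite set_coordE; case: eqP => [->|_].
  have [/andP[_ xb] /(_ (mem_head _ _)) xa] := hx i.
  split; last by move=> nis'; rewrite nis' in nis.
  rewrite cell_lo_ge ?xa//=.
  have /andP[h _] := cell_itv b L0 k (x 0 i).
  exact: le_trans (ltW h) xb.
by have [h1 h2] := hx j; split => // js; apply: h2; rewrite inE js orbT.
Qed.

(** At fixed meshes the quotient is a finite linear combination of values of the function at points
    of the closed box, so pointwise convergence there suffices. *)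
Lemma diff_quot_cvg p t ks (F_ : nat -> 'rV[R]_d -> R) F x :
  uniq (p ++ t) -> in_box (p ++ t) x ->
  (forall y, in_box t y -> F_ n y @[n --> \oo] --> F y) ->
  diff_quot p ks (F_ n) x @[n --> \oo] --> diff_quot p ks F x.
Proof.
move=> + + hF; elim: p ks x => [|i p IH] [|k ks]//= x.
- by move=> _; exact: hF.
- by move=> _; exact: hF.
- move=> _ hx; apply: hF => j; have [h1 h2] := hx j; split => // jt; apply: h2.
  by rewrite inE mem_cat jt !orbT.
move=> /andP[ni u] hx; apply: cvgM; first exact: cvg_cst.
apply: cvgB; apply: IH => //; [exact: in_box_set_up|exact: in_box_set_lo].
Qed.

(** The cell straddles x rather than starting at it. Derivability at x alone suffices: the
    linearization errors at the two ends are at most e times their distances to x, and these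
    distances add up to the mesh. *)
Lemma diff_quot1_cvg i F x : derivable F x (delta_mx 0 i) ->
  diff_quot [:: i] [:: k] F x @[k --> \oo] --> 'D_(delta_mx 0 i) F x.
Proof.
move=> dF; pose D : R := 'D_(delta_mx 0 i) F x.
pose g (u : R) := F (u *: delta_mx 0 i + x).
have dg (e : R) : 0 < e -> exists2 r, 0 < r &
    forall u, `|u| < r -> `|g u - g 0 - D * u| <= e * `|u|.
  move=> e0; have /cvgrPdist_le/(_ _ e0) := dF.
  move=> [r /= r0 hr]; exists r => // u ur.
  have [->|u0] := eqVneq u 0; first by rewrite subrr mulr0 subr0 normr0 mulr0.
  have /= := hr u; rewrite sub0r normrN => /(_ ur u0) h.
  have -> : g u - g 0 - D * u = - (u * (D - u^-1 * (g u - g 0))).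
    by field.
  rewrite normrN normrM mulrC ler_wpM2r//; apply: le_trans h.
  by rewrite /g scale0r add0r.
apply/cvgrPdist_le => e e0; have [r r0 hr] := dg _ e0.
near=> k.
have mr : mesh k < r.
  near: k; have /cvgrPdist_lt/(_ _ r0) := mesh_cvg0 L.
  by apply: filterS => k; rewrite sub0r normrN; apply: le_lt_trans; exact: ler_norm.
have m0 := mesh_gt0 L0 k.
rewrite /= !set_coord_delta -/(g _) -/(g _).
set y := x 0 i; have /andP[lox xup] := cell_itv b L0 k y.
have eu : lo k y = up k y - mesh k by [].
have nu : `|up k y - y| = up k y - y by rewrite ger0_norm// subr_ge0.
have nl : `|lo k y - y| = y - lo k y by rewrite distrC ger0_norm// subr_ge0 ltW.
have h1 := hr (up k y - y); rewrite nu in h1.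
have h2 := hr (lo k y - y); rewrite nl in h2.
have {}h1 := h1 ltac:(lra); have {}h2 := h2 ltac:(lra).
rewrite -/D -(ler_pM2l m0) -[X in X * `|_|](gtr0_norm m0) -normrM.
have -> : mesh k * (D - (mesh k)^-1 * (g (up k y - y) - g (lo k y - y))) =
    - ((g (up k y - y) - g 0 - D * (up k y - y)) -
       (g (lo k y - y) - g 0 - D * (lo k y - y))).
  by rewrite eu; field; exact: mesh_neq0.
rewrite normrN (le_trans (ler_normB _ _))//.
have -> : mesh k * e = e * (up k y - y) + e * (y - lo k y) by rewrite eu; ring.
exact: lerD.
Unshelve. all: by end_near. Qed.

Lemma set_coord_cvg i x (u : nat -> R) : u k @[k --> \oo] --> x 0 i ->
  set_coord i (u k) x @[k --> \oo] --> x.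
Proof.
move=> h; under eq_cvg do rewrite set_coord_delta.
have : (u k - x 0 i) *: delta_mx 0 i + x @[k --> \oo] -->
    (x 0 i - x 0 i) *: (delta_mx 0 i : 'rV[R]_d) + x.
  apply: cvgD; last exact: cvg_cst.
  by apply: cvgZ; [apply: cvgB => //|]; exact: cvg_cst.
by rewrite subrr scale0r add0r.
Qed.

Lemma cell_lo_cvg (v : R) : lo k v @[k --> \oo] --> v.
Proof.
have : lo k v @[k --> \oo] --> v - 0.
  by apply: cvgB; [exact: cell_up_cvg|exact: mesh_cvg0].
by rewrite subr0.
Qed.

(** Both cell ends tend to x, so for large k they lie in the neighbourhood on which the lower
    derivative exists; this gives the inner limits there, and derivability at x gives the outer
    one. *)
Lemma itlim_diff_quot s F x : has_partial s F x ->
  itlim (size s) (fun ks => diff_quot s ks F x) (partial s F x).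
Proof.
elim: s x => [//|i s IH] x /= [hn dF].
exists (fun k => diff_quot [:: i] [:: k] (partial s F) x); last exact: diff_quot1_cvg.
have hup := set_coord_cvg (@cell_up_cvg R b L L0 (x 0 i)).
have hlo := set_coord_cvg (@cell_lo_cvg (x 0 i)).
near=> k; apply: itlimZ; apply: itlimB; apply: IH; near: k.
  exact: hup.
exact: hlo.
Unshelve. all: by end_near. Qed.

End difference_quotients.

(** * The Borel sigma-algebra of row vectors *)

Section borel_structure.
Context (R : realType) (d : nat).

Let borel0 : (borel : set (set 'rV[R]_d)) set0.
Proof. exact: sigma_algebra0. Qed.

Let borelC (A : set 'rV[R]_d) : borel A -> borel (~` A).
Proof. by move=> bA; rewrite -setTD; exact: sigma_algebraCD. Qed.

Let borel_bigcup (F : (set 'rV[R]_d)^nat) :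
  (forall i, borel (F i)) -> borel (\bigcup_i F i).
Proof. exact: sigma_algebra_bigcup. Qed.

(** With this instance [measurable] for sets of row vectors is [borel] by conversion. *)
HB.instance Definition _ := @isMeasurable.Build default_measure_display
  'rV[R]_d borel borel0 borelC borel_bigcup.

End borel_structure.

Section borel_facts.
Context (R : realType) (d : nat).

Lemma measurable_coord (i : 'I_d) : measurable_fun setT (fun x : 'rV[R]_d => x 0 i).
Proof.
apply: (measurability _ (RGenOpens.measurableE R)) => _ [_ [a [b ->]] <-].
rewrite setTI; apply: sub_sigma_algebra.
apply: (open_comp (f := fun x : 'rV[R]_d => x 0 i)); last exact: interval_open.
by move=> x _; exact: coord_continuous.
Qed.

(** Second countability: an open set is the union of the countably many rational boxes that it
    contains. *)
Lemma measurable_rV dT (T : measurableType dT) (f : T -> 'rV[R]_d) :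
  (forall i, measurable_fun setT (fun w => f w 0 i)) -> measurable_fun setT f.
Proof.
move=> mf.
apply: (@measurability _ _ _ _ setT f [set A : set 'rV[R]_d | open A]) => // _ [A oA <-].
rewrite setTI.
pose box (q : 'rV[rat]_d * nat) : set 'rV[R]_d :=
  [set y | forall i, `|y 0 i - ratr (q.1 0 i)| < q.2.+1%:R^-1].
have -> : A = \bigcup_(q in [set q | box q `<=` A]) box q.
  apply/seteqP; split => [x Ax|x [q /= qA /qA]//].
  have /nbhs_ballP[e /= e0 heA] : nbhs x A by apply: open_nbhs_nbhs.
  (* Twice the radius, since a point of the box is compared with x through the rational centre. *)
  have [n hn] : exists n : nat, 2 * n.+1%:R^-1 < e.
    exists (Num.bound (2 / e)); rewrite ltr_pdivrMr ?ltr0n//.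
    have : 2 / e < (Num.bound (2 / e))%:R by rewrite archi_boundP// divr_ge0// ltW.
    by rewrite ltr_pdivrMr// => /lt_le_trans; apply; rewrite mulrC ler_pM2l// ler_nat.
  have n0 : 0 < n.+1%:R^-1 :> R by rewrite invr_gt0.
  have hq i : {q : rat | `|x 0 i - ratr q| < n.+1%:R^-1}.
    apply: cid; have [|q] := @rat_in_itvoo R (x 0 i - n.+1%:R^-1) (x 0 i + n.+1%:R^-1).
      by rewrite ltrD2l (lt_trans _ n0)// oppr_lt0.
    by rewrite in_itv/= => /andP[h1 h2]; exists q; rewrite ltr_distlC h1 h2.
  exists (\row_i sval (hq i), n); last by move=> i; rewrite mxE/=; case: (hq i).
  move=> y hy /=; apply: heA; split => // i j; rewrite ord1 /ball/=.
  have := hy j; rewrite /= mxE; case: (hq j) => q /= h1 h2.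
  rewrite -(subrK (ratr q) (x 0 j)) -addrA (le_lt_trans (ler_normD _ _))//.
  apply: (lt_trans _ hn); rewrite mulr_natl mulr2n ltrD//.
  by rewrite distrC.
rewrite preimage_bigcup bigcup_mkcond; apply: countable_bigcupT_measurable => //= q.
case: ifPn => // _.
have -> : f @^-1` box q = \bigcap_(i in [set: 'I_d])
    ((fun w => f w 0 i) @^-1` ball (ratr (q.1 0 i) : R) (q.2.+1%:R^-1)).
  apply/seteqP; split => w /= h i; first by move=> _; rewrite /ball/= distrC.
  by have := h i I; rewrite /ball/= distrC.
apply: fin_bigcap_measurable => // i _.
by rewrite -[X in measurable X]setTI; apply: mf => //; exact: measurable_ball.
Qed.

End borel_facts.

(** * The algebra of unions of grid cells *)

Section grid_algebra.
Context (R : realType) (d : nat) (b L : R).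
Hypothesis L0 : 0 < L.
Local Notation up := (cell_up b L).
Implicit Types (A : set 'rV[R]_d) (x : 'rV[R]_d).

Definition round_all k x : 'rV[R]_d := \row_j up k (x 0 j).

(** The union over all levels of the sigma-algebras generated by the cells of one level. *)
Definition grid_algebra : set (set 'rV[R]_d) :=
  [set A | measurable A /\ exists k0, forall x, A (round_all k0 x) = A x].

Lemma grid_algebra_le A k0 k x : (forall x, A (round_all k0 x) = A x) ->
  (k0 <= k)%N -> A (round_all k x) = A x.
Proof.
move=> h k0k; rewrite -h -[RHS]h; congr A; apply/rowP => j.
by rewrite !mxE cell_up_up.
Qed.

Lemma grid_algebraT : grid_algebra setT.
Proof. by split => //; exists 0%N. Qed.

Lemma grid_algebraC : setC_closed grid_algebra.
Proof.
move=> A [mA [k h]]; split; first exact: measurableC.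
by exists k => x; rewrite /setC /= h.
Qed.

Lemma grid_algebraI : setI_closed grid_algebra.
Proof.
move=> A A' [mA [k h]] [mA' [k' h']]; split; first exact: measurableI.
exists (maxn k k') => x; rewrite /setI /=.
by rewrite (grid_algebra_le x h (leq_maxl k k')) (grid_algebra_le x h' (leq_maxr k k')).
Qed.

(** The upper cell ends decrease to the point, so a closed half-space x_i >= a is the intersection
    over k of the sets where the rounded coordinate is at least a. *)
Lemma grid_algebra_generates : @measurable _ 'rV[R]_d = <<s grid_algebra >>.
Proof.
apply/seteqP; split => A; last first.
  by move: A; apply: smallest_sub; [exact: sigma_algebra_measurable|move=> A []].
move=> mA.
pose T := g_sigma_algebraType grid_algebra.
(* The inclusion of sigma-algebras is read as measurability of the identity, which can be checked
   coordinate by coordinate. *)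
suff mid : measurable_fun [set: T] (fun x : T => x : 'rV[R]_d).
  by have := mid measurableT A mA; rewrite setTI.
apply: measurable_rV => i.
apply: (@measurability _ _ _ _ _ _ _ (RGenCInfty.measurableE R)) => _ [_ [a ->] <-].
rewrite setTI.
have -> : (fun x : 'rV[R]_d => x 0 i) @^-1` `[a, +oo[%classic =
    \bigcap_k [set x : 'rV[R]_d | a <= up k (x 0 i)].
  apply/seteqP; split => x /=; rewrite in_itv/= andbT.
    by move=> h k _ /=; have /andP[_] := cell_itv b L0 k (x 0 i); exact: le_trans.
  move=> h; have upx := @cell_up_cvg R b L L0 (x 0 i).
  rewrite -(cvg_lim _ upx)//; apply: limr_ge; first by apply/cvg_ex; exists (x 0 i).
  by apply: nearW => k; exact: (h k I).
apply: (@bigcapT_measurable _ T) => k.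
apply: sub_sigma_algebra; split.
  have -> : [set x : 'rV[R]_d | a <= up k (x 0 i)] =
      (fun x : 'rV[R]_d => x 0 i) @^-1` (up k @^-1` `[a, +oo[%classic).
    by apply/seteqP; split => x /=; rewrite in_itv/= andbT.
  rewrite -[X in measurable X]setTI; apply: measurable_coord => //.
  by rewrite -[X in measurable X]setTI; apply: (measurable_cell_up b L0).
by exists k => x; rewrite /= mxE cell_up_up.
Qed.

Lemma mem_zip_index (J : eqType) (s : seq J) (ks : seq nat) j :
  size ks = size s -> j \in s -> (j, nth 0%N ks (index j s)) \in zip s ks.
Proof.
move=> sks js.
have -> : (j, nth 0%N ks (index j s)) = nth (j, 0%N) (zip s ks) (index j s).
  by rewrite nth_zip// nth_index.
by rewrite mem_nth// size_zip sks minnn index_mem.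
Qed.

Lemma round_up_inv A s ks k0 x : (forall x, A (round_all k0 x) = A x) ->
  uniq s -> size ks = size s -> all (leq k0) ks -> A (round_up b L s ks x) = A x.
Proof.
move=> h us sks hks; rewrite -h -[RHS]h; congr A; apply/rowP => j; rewrite !mxE.
have [js|js] := boolP (j \in s); last by rewrite round_up_notin.
pose k := nth 0%N ks (index j s).
have jk : (j, k) \in zip s ks by exact: mem_zip_index.
rewrite (round_up_in b L x us jk) /= cell_up_up//.
by apply: (allP hks); rewrite mem_nth// sks index_mem.
Qed.

Lemma measurable_round_up (s : seq 'I_d) ks : measurable_fun setT (round_up b L s ks).
Proof.
elim: s ks => [|i s IH] [|k ks] //=; apply: measurable_rV => j.
rewrite /=; under eq_fun do rewrite set_coordE.
case: eqP => _; last exact: measurableT_comp (measurable_coord j) (IH ks).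
exact: measurableT_comp (measurable_cell_up b L0 k) (measurable_coord i).
Qed.

End grid_algebra.

(** * Cells and the increments of a distribution function *)

Section cells.
Context (R : realType) (d : nat) (b L : R).
Hypothesis L0 : 0 < L.
Local Notation up := (cell_up b L).
Local Notation lo := (cell_lo b L).
Implicit Types (s : seq 'I_d) (ks : seq nat) (x : 'rV[R]_d).

Lemma zip_nth_index (J : eqType) (u : seq J) ks q : uniq u -> q \in zip u ks ->
  q.2 = nth 0%N ks (index q.1 u).
Proof.
elim: u ks => [|i u IH] [|k ks]//= /andP[ni uu]; rewrite inE => /orP[/eqP->|qz] /=.
  by rewrite eqxx.
by case: eqP => [e|_]; [move: ni; rewrite e (mem_zip_fst qz)|exact: IH].
Qed.

Definition lower_orthant x : set 'rV[R]_d := [set z | forall j, z 0 j <= x 0 j].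

(** Interpolates between a lower orthant ([s] empty) and a grid cell ([s] all coordinates); its mass
    is the numerator of the difference quotient over [s]. *)
Definition half_cell s ks x : set 'rV[R]_d :=
  [set z | (forall q, q \in zip s ks -> lo q.2 (x 0 q.1) < z 0 q.1 <= up q.2 (x 0 q.1))
           /\ forall j, j \notin s -> z 0 j <= x 0 j].

Lemma measurable_rectangle (I : 'I_d -> set R) : (forall j, measurable (I j)) ->
  measurable [set z : 'rV[R]_d | forall j, I j (z 0 j)].
Proof.
move=> mI.
have -> : [set z : 'rV[R]_d | forall j, I j (z 0 j)] =
    \bigcap_(j in [set: 'I_d]) ((fun z : 'rV[R]_d => z 0 j) @^-1` I j).
  by apply/seteqP; split => z /= h j => [_|]; exact: h.
apply: fin_bigcap_measurable => // j _.
by rewrite -[X in measurable X]setTI; exact: measurable_coord.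
Qed.

Lemma measurable_lower_orthant x : measurable (lower_orthant x).
Proof.
have -> : lower_orthant x = [set z | forall j, `]-oo, x 0 j]%classic (z 0 j)].
  by apply/seteqP; split => z /= h j; have := h j; rewrite in_itv.
by apply: (@measurable_rectangle (fun j => `]-oo, x 0 j]%classic)).
Qed.

Lemma half_cell_nil ks x : half_cell [::] ks x = lower_orthant x.
Proof.
apply/seteqP; split => z /=; first by move=> [_ h] j; exact: h.
by move=> h; split => // q; case: ks.
Qed.

Lemma half_cell_cons i s k ks x : i \notin s ->
  half_cell (i :: s) (k :: ks) x =
  half_cell s ks (set_coord i (up k (x 0 i)) x) `\`
  half_cell s ks (set_coord i (lo k (x 0 i)) x).
Proof.
move=> nis.
have qi (q : 'I_d * nat) : q \in zip s ks -> q.1 != i.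
  by move=> qs; apply: contraNneq nis => <-; exact: mem_zip_fst qs.
apply/seteqP; split => z /=.
  move=> [h1 h2]; have /andP[h3 h4] := h1 (i, k) (mem_head _ _).
  split.
    split=> [q qs|j js].
      by rewrite set_coord_neq ?qi//; apply: h1; rewrite inE qs orbT.
    rewrite set_coordE; case: eqP => [->//|/eqP ji]; apply: h2.
    by rewrite inE negb_or ji.
  by move=> [_ /(_ i nis)]; rewrite set_coord_id leNgt h3.
move=> [[h1 h2] h3].
have zi : lo k (x 0 i) < z 0 i.
  rewrite ltNge; apply/negP => zi; apply: h3; split=> [q qs|j js].
    by have := h1 q qs; rewrite !set_coord_neq ?qi.
  by have := h2 j js; rewrite !set_coordE; case: eqP => // ->.
split=> [q|j]; rewrite inE.
  move=> /orP[/eqP ->/=|qs]; last by have := h1 q qs; rewrite set_coord_neq ?qi.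
  by rewrite zi; have := h2 i nis; rewrite set_coord_id.
by rewrite negb_or => /andP[ji js]; have := h2 j js; rewrite set_coord_neq.
Qed.

Lemma half_cell_sub i s k ks x : i \notin s ->
  half_cell s ks (set_coord i (lo k (x 0 i)) x) `<=`
  half_cell s ks (set_coord i (up k (x 0 i)) x).
Proof.
move=> nis z [h1 h2]; split=> [q qs|j js].
  have qi : q.1 != i by apply: contraNneq nis => <-; exact: mem_zip_fst qs.
  by have := h1 q qs; rewrite !set_coord_neq.
have := h2 j js; rewrite !set_coordE; case: eqP => // _ /le_trans; apply.
by have /andP[h] := cell_itv b L0 k (x 0 i); apply: le_trans; exact: ltW.
Qed.

Lemma measurable_half_cell s ks x : uniq s -> size ks = size s ->
  measurable (half_cell s ks x).
Proof.
elim: s ks x => [|i s IH] ks x.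
  by rewrite half_cell_nil => _ _; exact: measurable_lower_orthant.
case: ks => [|k ks]//= /andP[nis us] [sks]; rewrite half_cell_cons//.
by apply: measurableD; exact: IH.
Qed.

Variable mu : {measure set 'rV[R]_d -> \bar R}.
Hypothesis mufin : (mu setT < +oo)%E.

Definition measure_cdf x : R := fine (mu (lower_orthant x)).

Lemma measure_fin_num A : measurable A -> mu A \is a fin_num.
Proof.
move=> mA; rewrite ge0_fin_numE//; apply: le_lt_trans mufin.
by apply: le_measure; rewrite ?inE.
Qed.

(** Each difference removes a set from a larger one, by [half_cell_cons], so masses subtract one
    coordinate at a time, without inclusion-exclusion over the corners. *)
Lemma diff_quot_cdf s ks x : uniq s -> size ks = size s ->
  diff_quot b L s ks measure_cdf x =
  (\prod_(k <- ks) mesh L k)^-1 * fine (mu (half_cell s ks x)).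
Proof.
elim: s ks x => [|i s IH] ks x.
  by case: ks => // _ _; rewrite half_cell_nil big_nil invr1 mul1r.
case: ks => [|k ks]//= /andP[nis us] [sks].
rewrite !IH// -mulrBr mulrA big_cons; congr (_ * _); first by rewrite [RHS]invfM.
have mc := measurable_half_cell _ us sks.
rewrite half_cell_cons// measureD//=; last first.
  by rewrite -ge0_fin_numE// measure_fin_num.
rewrite setIidr; last exact: half_cell_sub.
by rewrite fineB// measure_fin_num.
Qed.

Lemma diff_quot_cdf_ge0 s ks x : uniq s -> size ks = size s ->
  0 <= diff_quot b L s ks measure_cdf x.
Proof.
move=> us sks; rewrite diff_quot_cdf// mulr_ge0 ?fine_ge0// invr_ge0.
by apply: prodr_ge0 => k _; exact/ltW/mesh_gt0.
Qed.

Definition grid_box : set 'rV[R]_d := [set x | forall j, b - L < x 0 j <= b].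

Lemma measurable_grid_box : measurable grid_box.
Proof.
have -> : grid_box = [set z | forall j, `]b - L, b]%classic (z 0 j)].
  by apply/seteqP; split => z /= h j; have := h j; rewrite in_itv.
by apply: (@measurable_rectangle (fun j => `]b - L, b]%classic)).
Qed.

Lemma round_up_grid_box s ks x : grid_box x -> grid_box (round_up b L s ks x).
Proof.
move=> hx; elim: s ks => [|i s IH] [|k ks]//= j; rewrite set_coordE.
case: eqP => _; last exact: IH.
have /andP[h1 h2] := hx i; rewrite cell_up_le// andbT.
by have /andP[_] := cell_itv b L0 k (x 0 i); exact: lt_le_trans.
Qed.

Lemma half_cell_grid_box s ks x : (forall j, j \in s) -> size ks = size s ->
  grid_box x -> half_cell s ks x `<=` grid_box.
Proof.
move=> alls sks hx z [hz _] j.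
have /hz/= /andP[h1 h2] := mem_zip_index sks (alls j).
have := hx j => hxj; have /andP[h3 h4] := hxj.
rewrite (le_lt_trans _ h1)/= ?(cell_lo_ge L0)//.
by rewrite (le_trans h2)// cell_up_le.
Qed.

Variable lam : {measure set 'rV[R]_d -> \bar R}.
Hypothesis lam_cell : forall s ks x, uniq s -> (forall j, j \in s) -> size ks = size s ->
  grid_box x -> lam (half_cell s ks x) = (\prod_(k <- ks) mesh L k)%:E.

Lemma density_on_cells s ks : uniq s -> (forall j, j \in s) -> size ks = size s ->
  density_on lam mu grid_box (round_up b L s ks) (diff_quot b L s ks measure_cdf).
Proof.
move=> us alls sks.
pose kk (j : 'I_d) := nth 0%N ks (index j s).
(* At every level in [ks] the cell indices of the box are below M, so [inord] never truncates and
   [c], the tuple of indices, colours the box by its cells with finitely many colours. *)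
pose M := (2 ^ (\max_(k <- ks) k))%N.
have zipk q : q \in zip s ks -> q.2 = kk q.1 by exact: zip_nth_index.
have idx (x : 'rV[R]_d) (j : 'I_d) : grid_box x -> (0 <= cell_index b L (kk j) (x 0 j)) /\
    (`|cell_index b L (kk j) (x 0%R j)| < M.+1)%N.
  move=> /(_ j) /(cell_index_bound L0 (kk j))[h1 h2]; split => //.
  rewrite -(ltr_nat R) natr_absz ger0_norm// (@lt_le_trans _ _ (2 ^+ kk j))//.
    by apply: lt_le_trans h2; rewrite ltrDl.
  rewrite -natrX ler_nat (@leq_trans M)// leq_exp2l//.
  apply: leq_bigmax_seq => //; rewrite mem_nth// sks index_mem; exact: alls.
pose c x : {ffun 'I_d -> 'I_M.+1} :=
  [ffun j => inord `|cell_index b L (kk j) (x 0 j)|].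
have cP x y : grid_box x -> grid_box y ->
    c x = c y <-> forall j, up (kk j) (x 0 j) = up (kk j) (y 0 j).
  move=> bx by_; split => [e j|e].
    have := congr1 (fun f : {ffun 'I_d -> 'I_M.+1} => val (f j)) e.
    have [x0 xM] := idx x j bx; have [y0 yM] := idx y j by_.
    rewrite /= !ffunE !inordK// => exy.
    by rewrite /cell_up -(gez0_abs x0) -(gez0_abs y0) exy.
  apply/ffunP => j; rewrite !ffunE; congr (inord `|_|).
  have := e j; rewrite /cell_up => /addrI/oppr_inj/(mulfI (mesh_neq0 L0 _)).
  by move/eqP; rewrite eqr_int => /eqP.
have fiber x : grid_box x -> grid_box `&` c @^-1` [set c x] = half_cell s ks x.
  move=> bx; apply/seteqP; split => z.
    move=> [bz /(cP _ _ bz bx) e]; split => [q qz|j]; last by rewrite alls.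
    by rewrite (zipk q qz) cell_eqP// e.
  move=> hz; have bz := half_cell_grid_box alls sks bx hz; split => //.
  apply/(cP _ _ bz bx) => j; apply/eqP; rewrite -cell_eqP//.
  exact: (hz.1 _ (mem_zip_index sks (alls j))).
have mc x : measurable (half_cell s ks x) by exact: measurable_half_cell.
apply: (@density_on_partition _ _ _ _ _ _ measurable_grid_box _ c).
- by move=> x bx; rewrite fiber.
- move=> x y bx by_ /(cP _ _ bx by_) e; split.
    apply/rowP => j; have jz := mem_zip_index sks (alls j).
    by rewrite !(round_up_in b L _ us jz)/= e.
  apply: diff_quot_eq => // [q qz|j]; last by rewrite alls.
  by rewrite (zipk q qz) e.
- by move=> x _; exact: diff_quot_cdf_ge0.
- move=> x bx; rewrite fiber// lam_cell// diff_quot_cdf//.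
  rewrite -EFinM mulrC mulrA divff ?mul1r ?fineK// ?measure_fin_num//.
  by rewrite prodf_seq_neq0; apply/allP => k _ /=; exact: mesh_neq0.
Qed.

End cells.

Lemma has_partial_cat (R : realType) (d : nat) (a t : seq 'I_d) (F : 'rV[R]_d -> R) x :
  has_partial (a ++ t) F x -> has_partial t F x.
Proof. by elim: a => //= i a IH [/nbhs_singleton h _]; exact: IH. Qed.

(** P A is at most 1 minus the [rho]-mass of the complement of A, while Q A is at least [rho A];
    subtract, and exchange the roles of P and Q. *)
Lemma tv_common_part dT (T : measurableType dT) (R : realType)
    (P Q rho : {measure set T -> \bar R}) :
  P setT = 1%E -> Q setT = 1%E ->
  (forall A, measurable A -> (rho A <= P A)%E) ->
  (forall A, measurable A -> (rho A <= Q A)%E) ->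
  forall A, measurable A -> (`|P A - Q A| <= 1 - rho setT)%E.
Proof.
move=> P1 Q1 rP rQ A mA; have mA' := measurableC mA.
have le1 (m : {measure set T -> \bar R}) S : m setT = 1%E -> measurable S -> (m S < +oo)%E.
  move=> m1 mS; apply: (@le_lt_trans _ _ (m setT)); last by rewrite m1 ltry.
  by apply: le_measure; rewrite ?inE.
have fin (m : {measure set T -> \bar R}) S : m setT = 1%E -> measurable S -> m S \is a fin_num.
  by move=> m1 mS; rewrite ge0_fin_numE// le1.
have rfin S : measurable S -> rho S \is a fin_num.
  by move=> mS; rewrite ge0_fin_numE// (le_lt_trans (rP _ mS))// le1.
have compl (m : {measure set T -> \bar R}) :
  (forall S, measurable S -> m S \is a fin_num) ->
  fine (m setT) = fine (m A) + fine (m (~` A)).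
  by move=> mfin; rewrite -fineD ?mfin// -measureU ?setUv// setICr.
have hP := compl P (fun S => fin P S P1); have hQ := compl Q (fun S => fin Q S Q1).
have hr := compl rho rfin; rewrite P1 in hP; rewrite Q1 in hQ.
have fle (m : {measure set T -> \bar R}) S : m setT = 1%E -> measurable S ->
    (rho S <= m S)%E -> fine (rho S) <= fine (m S).
  by move=> m1 mS; apply: fine_le; [exact: rfin|exact: fin].
have h1 := fle P A P1 mA (rP _ mA); have h2 := fle Q A Q1 mA (rQ _ mA).
have h3 := fle P _ P1 mA' (rP _ mA'); have h4 := fle Q _ Q1 mA' (rQ _ mA').
rewrite -(fineK (fin P A P1 mA)) -(fineK (fin Q A Q1 mA)) -(fineK (rfin _ measurableT)).
rewrite -EFinB -EFinB lee_fin ler_norml /= in hP hQ *.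
by apply/andP; split; lra.
Qed.

(** * Densities given by mixed partial derivatives *)

Section densities.
Context (R : realType) (d : nat) (b L : R).
Hypothesis L0 : 0 < L.
Local Notation B := (@grid_box R d b L).
Implicit Types (s p t : seq 'I_d) (ks : seq nat) (x : 'rV[R]_d).

Variable lam : {measure set 'rV[R]_d -> \bar R}.
Hypothesis lam_fin : (lam B < +oo)%E.
Hypothesis lam_cell : forall s ks x, uniq s -> (forall j, j \in s) -> size ks = size s ->
  B x -> lam (half_cell b L s ks x) = (\prod_(k <- ks) mesh L k)%:E.

Variable s : seq 'I_d.
Hypotheses (us : uniq s) (alls : forall j, j \in s).

Let mB : measurable B. Proof. exact: measurable_grid_box. Qed.

(* Induction on the coordinates already differentiated, t: density_on_limit with
   the filtration of the mesh levels of one more coordinate. *)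
Lemma density_on_partial_cdf (nu : {measure set 'rV[R]_d -> \bar R}) :
  (nu setT < +oo)%E ->
  (forall x, (forall j, b - L <= x 0 j <= b) -> has_partial s (measure_cdf nu) x) ->
  forall t p, s = p ++ t -> forall ks, size ks = size p ->
  density_on lam nu B (round_up b L p ks)
    (diff_quot b L p ks (partial t (measure_cdf nu))) /\
  forall x, B x -> 0 <= diff_quot b L p ks (partial t (measure_cdf nu)) x.
Proof.
move=> nufin hpart; elim=> [|i t IH] p sp ks sks.
  rewrite cats0 in sp; subst p; split; first exact: density_on_cells.
  by move=> x _; exact: diff_quot_cdf_ge0.
have spr : s = rcons p i ++ t by rewrite cat_rcons.
have skr k : size (rcons ks k) = size (rcons p i) by rewrite !size_rcons sks.
have upi : uniq (rcons p i) by move: us; rewrite spr cat_uniq => /and3P[].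
have nip : i \notin p by move: upi; rewrite rcons_uniq => /andP[].
have lim x : B x -> diff_quot b L (rcons p i) (rcons ks k) (partial t (measure_cdf nu)) x
    @[k --> \oo] --> diff_quot b L p ks (partial (i :: t) (measure_cdf nu)) x.
  move=> Bx; under eq_cvg do rewrite diff_quot_rcons//.
  apply: (@diff_quot_cvg _ _ _ _ L0 p [:: i]); first by rewrite cats1.
    by move=> j; have /andP[h1 h2] := Bx j; rewrite (ltW h1) h2.
  move=> y hy; apply: (diff_quot1_cvg b L0).
  have hy' : forall j, b - L <= y 0 j <= b by move=> j; have [] := hy j.
  have := hpart y hy'; rewrite sp => /has_partial_cat /=.
  by case.
have ge0 x : B x -> 0 <= diff_quot b L p ks (partial (i :: t) (measure_cdf nu)) x.
  move=> Bx; rewrite -(cvg_lim _ (lim x Bx))//; apply: limr_ge.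
    by apply/cvg_ex; eexists; exact: lim Bx.
  by apply: nearW => k; apply: (IH _ spr _ (skr k)).2.
split => //.
apply: (@density_on_limit _ _ _ lam nu B mB (@grid_algebra R d b L)
  (fun k => round_up b L (rcons p i) (rcons ks k)) _
  (fun k => diff_quot b L (rcons p i) (rcons ks k) (partial t (measure_cdf nu)))) => //.
- by apply: le_lt_trans nufin; apply: le_measure; rewrite ?inE.
- exact: grid_algebra_generates.
- exact: grid_algebraI.
- exact: measurable_round_up.
- by move=> k x; exact: round_up_grid_box.
(* Compatibility along the filtration: the quotient of mesh level j sees only the cell of level j,
   which rounding at a finer level preserves. *)
- move=> j k x jk _; apply: diff_quot_eq => // [q|m mp]; last by rewrite round_up_notin.
  rewrite zip_rcons// mem_rcons inE => /orP[/eqP->/=|qz].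
    have := @round_up_in _ _ b L _ (rcons ks k) x (i, k) upi; rewrite zip_rcons//.
    by rewrite mem_rcons mem_head => /(_ isT) /= ->; rewrite cell_up_up.
  rewrite (@round_up_in _ _ b L _ (rcons ks k) x q upi).
    by rewrite cell_up_up.
  by rewrite zip_rcons// mem_rcons inE qz orbT.
(* From level [k0] on, rounding the coordinate [i] does not affect membership in A; the levels [ks]
   of the other coordinates stay fixed. *)
- move=> A [mA [k0 hk0]]; exists k0 => k k0k; apply/funext => x /=.
  rewrite /preimage/= round_up_rcons// -[LHS]hk0 -[RHS]hk0; congr A; apply/rowP => j.
  rewrite !mxE; case: eqP => [->|//].
  by rewrite round_up_notin// cell_up_up.
- by move=> k x Bx; apply: (IH _ spr _ (skr k)).2.
- by move=> k; exact: (IH _ spr _ (skr k)).1.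
Qed.

Definition lower_density (F : 'rV[R]_d -> R) x : \bar R :=
  itliminf (size s) (fun ks => (diff_quot b L s ks F x)%:E).

Lemma lower_density_partial F x : has_partial s F x ->
  lower_density F x = (partial s F x)%:E.
Proof. by move=> /(itlim_diff_quot b L0)/itlim_itliminf. Qed.

Section lower_density_le.
Variable mu : {measure set 'rV[R]_d -> \bar R}.
Hypothesis mufin : (mu setT < +oo)%E.
Local Open Scope ereal_scope.

Lemma lower_density_ge0 x : 0 <= lower_density (measure_cdf mu) x.
Proof. by apply: itliminf_ge0 => ks sks; rewrite lee_fin diff_quot_cdf_ge0. Qed.

Lemma measurable_lower_density : measurable_fun B (lower_density (measure_cdf mu)).
Proof.
apply: (measurable_itliminf
  (F := fun ks x => (diff_quot b L s ks (measure_cdf mu) x)%:E)) => ks sks.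
by apply/measurable_EFinP; have [] := density_on_cells L0 mufin lam_cell us alls sks.
Qed.

(** On a set of the grid algebra every sufficiently fine quotient integrates exactly to the mass of
    [mu], so Fatou applies there; [le_measure_algebra] extends the bound to all Borel sets. *)
Lemma lower_density_le A : measurable A ->
  \int[lam]_(x in B `&` A) lower_density (measure_cdf mu) x <= mu (B `&` A).
Proof.
pose f := lower_density (measure_cdf mu) \_ B.
have mf : measurable_fun setT f.
  by apply/(measurable_restrictT _ mB); exact: measurable_lower_density.
have f0 x : 0 <= f x by rewrite /f patchE; case: ifPn => // _; exact: lower_density_ge0.
pose rho : {measure set 'rV[R]_d -> \bar R} := density_measure lam mf f0.
have rhoE S : rho S = \int[lam]_(x in B `&` S) lower_density (measure_cdf mu) x.
  by rewrite setIC integral_mkcondr.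
pose muB : {measure set 'rV[R]_d -> \bar R} := mrestr mu mB.
have muBE S : muB S = mu (B `&` S) by rewrite setIC.
have grid_le S : grid_algebra b L S -> rho S <= muB S.
  move=> [mS [k0 hk0]]; rewrite rhoE muBE.
  apply: (@itliminf_fatou _ _ _ _ _ _ k0 (size s)
     (fun ks x => (diff_quot b L s ks (measure_cdf mu) x)%:E)).
  - exact: measurableI.
  - move=> ks sks; apply/measurable_EFinP.
    have [h _] := density_on_cells L0 mufin lam_cell us alls sks.
    by apply: measurable_funS h => //; exact: subIsetl.
  - by move=> ks x sks _; rewrite lee_fin diff_quot_cdf_ge0.
  - move=> ks sks hks; have [_ h] := density_on_cells L0 mufin lam_cell us alls sks.
    have := h S mS; rewrite (_ : round_up b L s ks @^-1` S = S) => [-> //|].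
    by apply/funext => x; exact: (round_up_inv L0 x hk0 us sks hks).
move=> mA; rewrite -rhoE -muBE.
have muBfin : muB setT < +oo.
  by rewrite muBE setIT; apply: le_lt_trans mufin; apply: le_measure; rewrite ?inE.
apply: (@le_measure_algebra _ _ _ rho muB (@grid_algebra R d b L)) => //.
- by apply: le_lt_trans muBfin; apply: grid_le; exact: grid_algebraT.
- exact: grid_algebra_generates.
- exact: grid_algebraI.
- exact: grid_algebraT.
- exact: grid_algebraC.
Qed.

End lower_density_le.
End densities.

(** * Total variation and the common part on a box *)

Section total_variation_bound.
Context (R : realType) (d : nat) (b L : R).
Hypothesis L0 : 0 < L.
Local Notation B := (@grid_box R d b L).
Variable lam : {measure set 'rV[R]_d -> \bar R}.
Hypothesis lam_fin : (lam B < +oo)%E.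
Hypothesis lam_cell : forall s ks (x : 'rV[R]_d), uniq s -> (forall j, j \in s) -> size ks = size s ->
  B x -> lam (half_cell b L s ks x) = (\prod_(k <- ks) mesh L k)%:E.
Variable s : seq 'I_d.
Hypotheses (us : uniq s) (alls : forall j, j \in s).
Variables (nu : {measure set 'rV[R]_d -> \bar R}).
Variables (mu_ : nat -> {measure set 'rV[R]_d -> \bar R}).
Hypotheses (nu1 : nu setT = 1%E) (mu1 : forall n, mu_ n setT = 1%E).
Hypothesis nu_partial : forall x : 'rV[R]_d, (forall j, b - L <= x 0 j <= b) ->
  has_partial s (measure_cdf nu) x.
Hypothesis mu_partial : forall x : 'rV[R]_d, B x ->
  (\forall n \near \oo, has_partial s (measure_cdf (mu_ n)) x) /\
  partial s (measure_cdf (mu_ n)) x @[n --> \oo] --> partial s (measure_cdf nu) x.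

(** The common part is sought only inside the box: the mass of [nu] outside it is lost, and [e] pays
    for the convergence of the integrals. *)
Lemma total_variation_bound (e : R) : 0 < e ->
  \forall n \near \oo, forall A, measurable A ->
    (`|mu_ n A - nu A| <= 1 - nu B + e%:E)%E.
Proof.
move=> e0; pose g := partial s (measure_cdf nu).
have mB : measurable B by exact: measurable_grid_box.
have nuoo : (nu setT < +oo)%E by rewrite nu1 ltry.
have muoo n : (mu_ n setT < +oo)%E by rewrite mu1 ltry.
(* With no coordinate left to round, [round_up] is the identity and the density statement covers all
   Borel subsets of the box. *)
have [[mg nug] g0] : density_on lam nu B id g /\ forall x, B x -> 0 <= g x.
  exact: (density_on_partial_cdf L0 lam_fin lam_cell us alls nuoo
    nu_partial (esym (cat0s s)) (erefl (size [::]))).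
pose f n := lower_density b L s (measure_cdf (mu_ n)).
have f0 n x : (0 <= f n x)%E by exact: lower_density_ge0.
have mf n : measurable_fun B (f n) by exact: (measurable_lower_density L0 lam_cell).
(* Cutting at [g] provides the integrable majorant; [f n] may take infinite values. *)
pose h n x := Order.min (f n x) (g x)%:E.
have mgE : measurable_fun B (EFin \o g) by apply/measurable_EFinP.
have mh n : measurable_fun B (h n) by exact: measurable_mine.
have h0 n x : B x -> (0 <= h n x)%E.
  by move=> Bx; rewrite /h le_min f0 lee_fin; exact: g0.
have hcvg x : B x -> h n x @[n --> \oo] --> (g x)%:E.
  move=> Bx; have [hp hl] := mu_partial Bx.
  have hmin (a c : R) : `|c - Num.min a c| <= `|c - a|.
    by case: (leP a c) => // _; rewrite subrr normr0.
  have : (Num.min (partial s (measure_cdf (mu_ n)) x) (g x))%:E @[n --> \oo] --> (g x)%:E.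
    apply/cvg_EFin; first exact: nearW.
    apply/cvgrPdist_le => r r0; move/cvgrPdist_le : hl => /(_ r r0).
    by apply: filterS => n hr /=; apply: le_trans hr; exact: hmin.
  apply: cvg_trans; apply: near_eq_cvg; apply: filterS hp => n hn.
  by rewrite /h /f lower_density_partial// EFin_min.
have rintE : (\int[lam]_(x in B) (g x)%:E = nu B)%E.
  by have := nug setT measurableT; rewrite preimage_setT setIT.
have gint : lam.-integrable B (EFin \o g).
  apply/integrableP; split => //.
  rewrite (eq_integral (EFin \o g)); last first.
    by move=> x; rewrite inE => Bx /=; rewrite ger0_norm// g0.
  by rewrite rintE; apply: le_lt_trans nuoo; apply: le_measure; rewrite ?inE.
have [_ _ hint] : [/\ lam.-integrable B (EFin \o g),
    (\int[lam]_(x in B) `|h n x - (g x)%:E|)%E @[n --> \oo] --> 0%E &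
    (\int[lam]_(x in B) h n x)%E @[n --> \oo] --> (\int[lam]_(x in B) (g x)%:E)%E].
  apply: (dominated_convergence mB mh mgE _ gint); first exact: aeW.
  apply: aeW => x n Bx /=; rewrite gee0_abs ?h0//.
  by rewrite /h ge_min lexx orbT.
have fin_nuB : nu B \is a fin_num.
  rewrite ge0_fin_numE//; apply: le_lt_trans nuoo; apply: le_measure; rewrite ?inE//.
rewrite rintE -(fineK fin_nuB) in hint.
have [hfin /cvgrPdist_le/(_ _ e0) hdist] := (fine_cvgP _ _).1 hint.
near=> n => A mA.
have hn0 x : (0 <= (h n \_ B) x)%E.
  by rewrite patchE; case: ifPn => // /[!inE]; exact: h0.
have mhn : measurable_fun setT (h n \_ B) by apply/(measurable_restrictT _ mB).
pose rho : {measure set 'rV[R]_d -> \bar R} := density_measure lam mhn hn0.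
have rhoE S : rho S = (\int[lam]_(x in B `&` S) h n x)%E.
  by rewrite setIC integral_mkcondr.
have mBS S : measurable S -> measurable (B `&` S) by exact: measurableI.
have rho_mu S : measurable S -> (rho S <= mu_ n S)%E.
  move=> mS; rewrite rhoE; apply: (@le_trans _ _ (mu_ n (B `&` S))); last first.
    by apply: le_measure; rewrite ?inE//; exact: mBS.
  apply: le_trans (lower_density_le L0 lam_cell us alls (muoo n) mS).
  apply: ge0_le_integral => //; [exact: mBS| | |  |].
  - by move=> x [Bx _]; exact: h0.
  - by apply: measurable_funS (mh n) => // x [].
  - by apply: measurable_funS (mf n) => // x [].
  - by move=> x _; rewrite /h ge_min lexx.
have rho_nu S : measurable S -> (rho S <= nu S)%E.
  move=> mS; rewrite rhoE; apply: (@le_trans _ _ (nu (B `&` S))); last first.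
    by apply: le_measure; rewrite ?inE//; exact: mBS.
  have := nug S mS; rewrite preimage_id => ->.
  apply: ge0_le_integral => //; [exact: mBS| | |  |].
  - by move=> x [Bx _]; exact: h0.
  - by apply: measurable_funS (mh n) => // x [].
  - by apply: measurable_funS mgE => // x [].
  - by move=> x _; rewrite /h ge_min lexx orbT.
apply: le_trans (tv_common_part (mu1 n) nu1 rho_mu rho_nu mA) _.
rewrite rhoE setIT.
have hfn : (\int[lam]_(x in B) h n x)%E \is a fin_num by near: n.
rewrite -(fineK hfn) -(fineK fin_nuB) -!EFinB -EFinD lee_fin.
have : `|fine (nu B) - fine (\int[lam]_(x in B) h n x)%E| <= e by near: n.
by rewrite ler_norml => /andP[_ hh]; lra.
Unshelve. all: by end_near. Qed.

End total_variation_bound.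

(** Iterated binary products, one space for each n. They serve twice: for the uniform law on a box
    and for the maxima of copies of a copula's random vector. *)
Lemma iid_copies (R : realType) dO (O : measurableType dO) (P : probability O R) n :
  exists (dn : measure_display) (On : measurableType dn) (Pn : probability On R)
    (pi : 'I_n -> On -> O), (forall i, measurable_fun setT (pi i)) /\
    forall A : 'I_n -> set O, (forall i, measurable (A i)) ->
      Pn [set w | forall i, A i (pi i w)] = (\prod_(i < n) P (A i))%E.
Proof.
elim: n => [|n [dn [On [Pn [pi [mpi hpi]]]]]].
  exists dO, O, P, (fun _ => id); split=> [[]//|A _].
  by rewrite big_ord0 -(probability_setT P); congr (P _); apply/seteqP; split => // w _ [].
exists _, (On * O)%type, (Pn \x P)%E.
exists (fun i w => if unlift ord0 i is Some j then pi j w.1 else w.2); split.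
  move=> i; case: unliftP => [j _|_]; last exact: measurable_snd.
  exact: measurableT_comp (mpi j) measurable_fst.
move=> A mA.
have -> : [set w : On * O | forall i, A i (if unlift ord0 i is Some j then pi j w.1 else w.2)]
    = [set w | forall j, A (lift ord0 j) (pi j w)] `*` A ord0.
  apply/seteqP; split => -[w1 w2] /=.
    move=> h; split => [j|]; first by have := h (lift ord0 j); rewrite liftK.
    by have := h ord0; rewrite unlift_none.
  by move=> [h1 h2] i; case: unliftP => [j|] -> //; exact: h1.
have mS : measurable [set w | forall j, A (lift ord0 j) (pi j w)].
  have -> : [set w | forall j, A (lift ord0 j) (pi j w)] =
      \bigcap_(j in [set: 'I_n]) (pi j @^-1` A (lift ord0 j)).
    by apply/seteqP; split => w /= h j => [_|]; exact: h.
  apply: fin_bigcap_measurable => // j _.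
  by rewrite -[X in measurable X]setTI; exact: mpi.
transitivity ((Pn \x P) ([set w | forall j, A (lift ord0 j) (pi j w)] `*` A ord0))%E => //.
rewrite product_measure1E// big_ord_recl muleC; congr (_ * _)%E.
exact: (hpi (fun j => A (lift ord0 j))).
Qed.

(** * Scheffe's lemma for distribution functions *)

Section scheffe.
Context (R : realType) (d : nat).

Lemma uniform_prob_itv (a b x y : R) (ab : a < b) : a <= x -> x <= y -> y <= b ->
  uniform_prob ab `]x, y]%classic = ((y - x) / (b - a))%:E.
Proof.
move=> ax xy yb; rewrite /uniform_prob integral_uniform_pdf.
have -> : `]x, y]%classic `&` `[a, b]%classic = `]x, y]%classic :> set R.
  apply/setIidl => z /=; rewrite !in_itv/= => /andP[h1 h2].
  by rewrite (le_trans h2 yb) (le_trans ax (ltW h1)).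
rewrite (eq_integral (cst (b - a)^-1%:E)); last first.
  move=> z; rewrite inE/= in_itv/= => /andP[h1 h2]; rewrite /uniform_pdf.
  by rewrite (le_trans h2 yb) (le_trans ax (ltW h1)).
rewrite integral_cst//= lebesgue_measure_itv/= lte_fin.
move: xy; rewrite le_eqVlt => /orP[/eqP->|xy]; last by rewrite xy -EFinB -EFinM mulrC.
by rewrite ltxx mule0 subrr mul0r.
Qed.

(** Lebesgue measure on the box, obtained from d independent uniform variables. *)
Lemma box_measure (b L : R) : 0 < L ->
  exists lam : {measure set 'rV[R]_d -> \bar R}, (lam (@grid_box R d b L) < +oo)%E /\
  forall s ks (x : 'rV[R]_d), uniq s -> (forall j, j \in s) -> size ks = size s ->
    grid_box b L x -> lam (half_cell b L s ks x) = (\prod_(k <- ks) mesh L k)%:E.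
Proof.
move=> L0; have ab : b - L < b by rewrite ltrBlDr ltrDl.
have [dn [On [Pn [pi [mpi hpi]]]]] := iid_copies (uniform_prob ab) d.
pose V (w : On) : 'rV[R]_d := \row_j pi j w.
have mV : measurable_fun setT V.
  by apply: measurable_rV => i; under eq_fun do rewrite mxE; exact: mpi.
have LN : (0 <= L ^+ d)%R by rewrite exprn_ge0// ltW.
pose VM : {mfun On >-> 'rV[R]_d} := mfun_Sub (mem_set mV).
pose law : {measure set 'rV[R]_d -> \bar R} := distribution Pn VM.
have lawE S : law S = Pn (V @^-1` S) by [].
(* The factor L^d turns the probability mesh / L of each edge of a cell into its length. *)
exists (mscale (NngNum LN) law); split.
  rewrite /= /mscale/= lte_mul_pinfty// ?lee_fin//.
  have mB := @measurable_grid_box R d b L.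
  apply: (@le_lt_trans _ _ 1%E); last by rewrite ltry.
  by rewrite probability_le1.
move=> s ks x us alls sks Bx.
pose kk (j : 'I_d) := nth 0%N ks (index j s).
have -> : half_cell b L s ks x = [set z | forall j,
    `]cell_lo b L (kk j) (x 0 j), cell_up b L (kk j) (x 0 j)]%classic (z 0 j)].
  apply/seteqP; split => z.
    by move=> [h _] j; rewrite /= in_itv/=; exact: (h _ (mem_zip_index sks (alls j))).
  move=> h; split => [q qz|j]; last by rewrite alls.
  by have := h q.1; rewrite /= in_itv/= (zip_nth_index us qz).
rewrite /= /mscale/= lawE.
have -> : V @^-1` [set z | forall j,
    `]cell_lo b L (kk j) (x 0 j), cell_up b L (kk j) (x 0 j)]%classic (z 0 j)] =
  [set w | forall j, `]cell_lo b L (kk j) (x 0 j), cell_up b L (kk j) (x 0 j)]%classic (pi j w)].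
  by apply/seteqP; split => w /= h j; have := h j; rewrite mxE.
rewrite (hpi (fun j => `]cell_lo b L (kk j) (x 0 j), cell_up b L (kk j) (x 0 j)]%classic))//.
rewrite (eq_bigr (fun j => (mesh L (kk j) / L)%:E)); last first.
  move=> j _; have Bj := Bx j; have /andP[_ xb] := Bj.
  apply: (eq_trans (uniform_prob_itv ab _ _ _)).
  - exact: cell_lo_ge.
  - by rewrite /cell_lo gerBl ltW// mesh_gt0.
  - exact: cell_up_le.
  - by rewrite /cell_lo; congr ((_ / _)%:E); ring.
rewrite prodEFin -EFinM; congr EFin.
rewrite big_split/= prodr_const card_ord mulrCA -exprMn divff ?gt_eqF// expr1n mulr1.
(* The levels are listed in the order of [s]; since [s] enumerates all coordinates, the product over
   [ks] becomes one over 'I_d. *)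
have -> : ks = map kk s.
  apply: (@eq_from_nth _ 0%N); first by rewrite size_map.
  move=> i; rewrite sks => il; case: s us alls sks il @kk => // j s us alls sks il kk.
  by rewrite (nth_map j)// /kk index_uniq.
rewrite big_map -[LHS](big_enum_cond _ _ predT)/=.
by apply: perm_big; apply: uniq_perm => //; [exact: enum_uniq|move=> j; rewrite mem_enum alls].
Qed.

(** One fixed box that misses at most e/2 of the mass of [nu] suffices, and the remaining e/2 goes
    into [total_variation_bound]. *)
Lemma scheffe_cdf (s : seq 'I_d) (nu : {measure set 'rV[R]_d -> \bar R})
    (mu_ : nat -> {measure set 'rV[R]_d -> \bar R}) :
  uniq s -> (forall j, j \in s) ->
  nu setT = 1%E -> (forall n, mu_ n setT = 1%E) -> nu neg_orthant = 1%E ->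
  (forall x, neg_orthant x -> has_partial s (measure_cdf nu) x) ->
  (forall x, neg_orthant x ->
    (\forall n \near \oo, has_partial s (measure_cdf (mu_ n)) x) /\
    partial s (measure_cdf (mu_ n)) x @[n --> \oo] --> partial s (measure_cdf nu) x) ->
  forall e : R, 0 < e -> \forall n \near \oo, forall A, measurable A ->
    (`|mu_ n A - nu A| <= e%:E)%E.
Proof.
move=> us alls nu1 mu1 nuneg hnu hmu e e0.
(* The edges are ]-(m+2), -1/(m+1)]: they increase to the negative half-line and stay away from 0.
   The offset 2 keeps the length positive already for m = 0. *)
pose b m : R := - m.+1%:R^-1.
pose L m : R := b m + m.+2%:R.
have m0 m : 0 < m.+1%:R^-1 :> R by rewrite invr_gt0.
have L0 m : 0 < L m.
  rewrite /L /b addrC subr_gt0 (@le_lt_trans _ _ 1)//; last by rewrite ltr1n.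
  by rewrite invf_le1// ler1n.
pose B m : set 'rV[R]_d := grid_box (b m) (L m).
have mB m : measurable (B m) by exact: measurable_grid_box.
have bL m : b m - L m = - m.+2%:R by rewrite /L opprD addrA subrr add0r.
have b0 m : b m < 0 by rewrite oppr_lt0.
have Bcup : \bigcup_m B m = neg_orthant.
  apply/seteqP; split => x.
    by move=> [m _ Bx] j; have /andP[_ h] := Bx j; exact: le_lt_trans (b0 m).
  move=> hx.
  have [m _ hm] : \forall m \near \oo, forall j, - m.+2%:R < x 0 j <= b m.
    apply: filter_forall => j; have xj : 0 < - x 0 j by rewrite oppr_gt0.
    near=> m.
    have h1 : - x 0 j < m%:R by near: m; exact: nbhs_infty_gtr.
    have h2 : (- x 0 j)^-1 < m%:R by near: m; exact: nbhs_infty_gtr.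
    rewrite /b lerNr -[leRHS]invrK lef_pV2 ?posrE ?ltr0n ?invr_gt0//.
    rewrite (le_trans (ltW h2)) ?ler_nat// andbT ltrNl (lt_trans h1)// ltr_nat.
    by rewrite ltnS leqnSn.
  by exists m => // j; rewrite bL; exact: (hm m (leqnn m)).
have ndB : nondecreasing_seq B.
  move=> m m' mm'; rewrite subsetEset => x Bx j; have := Bx j; rewrite !bL.
  move=> /andP[h1 h2]; rewrite (le_lt_trans _ h1) ?lerN2 ?ler_nat//=.
  by rewrite (le_trans h2)// lerN2 lef_pV2 ?posrE ?ltr0n// ler_nat.
have e20 : 0 < e / 2 by rewrite divr_gt0.
have mneg : measurable (@neg_orthant R d) by rewrite -Bcup; apply: bigcup_measurable.
have le1 S : measurable S -> (nu S < +oo)%E.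
  move=> mS; apply: (@le_lt_trans _ _ (nu setT)); last by rewrite nu1 ltry.
  by apply: le_measure; rewrite ?inE.
have fin S : measurable S -> nu S \is a fin_num.
  by move=> mS; rewrite ge0_fin_numE// le1.
have : nu (B m) @[m --> \oo] --> 1%:E.
  rewrite -nuneg -Bcup; apply: nondecreasing_cvg_mu => //.
  by rewrite Bcup.
move=> /fine_cvgP[_ /cvgrPdist_le/(_ _ e20)[m _ /(_ m (leqnn m))/=]] hm.
have [lam [lamfin lamcell]] := box_measure (b m) (L0 m).
have hb (x : 'rV[R]_d) : (forall j, x 0 j <= b m) -> neg_orthant x.
  by move=> h j; exact: le_lt_trans (h j) (b0 m).
have := @total_variation_bound _ _ _ _ (L0 m) lam lamfin lamcell s us alls nu mu_ nu1 mu1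
  _ _ _ e20.
have h1 : forall x : 'rV[R]_d, (forall j, b m - L m <= x 0 j <= b m) ->
    has_partial s (measure_cdf nu) x.
  by move=> x h; apply/hnu/hb => j; have /andP[] := h j.
have h2 : forall x : 'rV[R]_d, B m x ->
    (\forall n \near \oo, has_partial s (measure_cdf (mu_ n)) x) /\
    partial s (measure_cdf (mu_ n)) x @[n --> \oo] --> partial s (measure_cdf nu) x.
  by move=> x h; apply/hmu/hb => j; have /andP[] := h j.
move=> /(_ h1 h2); apply: filterS => n hn A mA; apply: (le_trans (hn A mA)).
rewrite -(fineK (fin _ (mB m))) -EFinB -EFinD lee_fin.
by move: hm; rewrite ler_norml => /andP[_]; lra.
Unshelve. all: by end_near. Qed.

End scheffe.

(** * Mixed partial derivatives of a power of the copula *)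

(** Restriction to a line gives access to the one-variable chain rule for functions that only have
    directional derivatives. *)
Lemma is_derive_line (R : realType) (V : normedModType R) (f : V -> R) x v df :
  is_derive x v f df <-> is_derive (0 : R) 1 (fun h : R => f (h *: v + x)) df.
Proof.
have e : 'D_1 (fun h : R => f (h *: v + x)) 0 = 'D_v f x.
  rewrite /derive; set g1 := fun h => h^-1 *: _; set g2 := fun h => h^-1 *: _.
  suff -> : g1 = g2 by [].
  by rewrite /g1 /g2; apply/funext => h /=; rewrite addr0 scale0r add0r [_%:A]mulr1.
split=> -[h1 h2]; apply: DeriveDef.
- exact: (derivable1P f x v).1 h1.
- exact: (etrans e h2).
- exact: (derivable1P f x v).2 h1.
- exact: (etrans (esym e) h2).
Qed.

Lemma is_derive_comp_line (R : realType) (V : normedModType R) (c : R -> R)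
    (u : V -> R) x v dc du :
  is_derive (u x) 1 c dc -> is_derive x v u du ->
  is_derive x v (fun y => c (u y)) (dc * du).
Proof.
move=> hc /is_derive_line hu; apply/is_derive_line.
apply: (@is_derive1_comp _ c (fun h : R => u (h *: v + x))) => //.
by rewrite scale0r add0r.
Qed.

(** Boolean masks index the subsequences by a finite type, and a filter is closed under finite
    intersections. *)
Lemma near_subseq (T : Type) (F : set_system T) (FF : Filter F) (I : eqType)
    (r : seq I) (P : seq I -> T -> Prop) :
  (forall t, subseq t r -> \forall y \near F, P t y) ->
  \forall y \near F, forall t, subseq t r -> P t y.
Proof.
move=> h.
have : \forall y \near F, forall m : (size r).-tuple bool, P (mask m r) y.
  apply: (@filter_forall _ _ (fun (m : (size r).-tuple bool) y => P (mask m r) y) F FF).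
  by move=> m; apply: h; exact: mask_subseq.
apply: filterS => y hy t /subseqP[m sm ->].
by have := hy (tcast sm (in_tuple m)); rewrite val_tcast.
Qed.

(** * The chain rule for mixed partial derivatives *)

Section faa_di_bruno.
Context (R : realType) (d : nat).
Implicit Types (s t : seq 'I_d) (pi : seq (seq 'I_d)) (x : 'rV[R]_d).
Implicit Types (u : 'rV[R]_d -> R).

(* A partition is the list of its blocks; extend_block lists the ways of adding
   i to one of them.  The leading i of a new block matches partial (i :: t). *)
Fixpoint extend_block (i : 'I_d) pi : seq (seq (seq 'I_d)) :=
  if pi is t :: pi' then ((i :: t) :: pi') :: map (cons t) (extend_block i pi')
  else [::].

Fixpoint set_partitions s : seq (seq (seq 'I_d)) :=
  if s is i :: s' then
    flatten [seq ([:: i] :: pi) :: extend_block i pi | pi <- set_partitions s']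
  else [:: [::]].

(** [c k] stands for the k-th derivative of the outer function and [p t] for the partial derivative
    of the inner one along the block [t]. *)
Definition faa_di_bruno s (c : nat -> R) (p : seq 'I_d -> R) : R :=
  \sum_(pi <- set_partitions s) c (size pi) * \prod_(t <- pi) p t.

Lemma size_extend_block i pi pi' : pi' \in extend_block i pi -> size pi' = size pi.
Proof.
elim: pi pi' => //= t pi IH pi'; rewrite inE => /orP[/eqP->//|/mapP[r /IH hr ->]] /=.
by rewrite hr.
Qed.

Lemma mem_extend_block i pi pi' t : pi' \in extend_block i pi -> t \in pi' ->
  t \in pi \/ exists2 t', t' \in pi & t = i :: t'.
Proof.
elim: pi pi' => //= r pi IH pi'; rewrite inE => /orP[/eqP->|/mapP[q hq ->]].
  rewrite inE => /orP[/eqP->|tp]; first by right; exists r => //; exact: mem_head.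
  by left; rewrite inE tp orbT.
rewrite inE => /orP[/eqP->|tq]; first by left; exact: mem_head.
have [tp|[t' t'p ->]] := IH q hq tq; first by left; rewrite inE tp orbT.
by right; exists t' => //; rewrite inE t'p orbT.
Qed.

(** Hence blocks are duplicate-free whenever [s] is, and the assumption on the derivatives of the
    copula applies to each of them. *)
Lemma set_partitions_subseq s pi t : pi \in set_partitions s -> t \in pi -> subseq t s.
Proof.
elim: s pi t => [|i s IH] pi t /=; first by rewrite inE => /eqP->.
have subi r : subseq r s -> subseq r (i :: s).
  by move=> h; apply: subseq_trans h (subseq_cons _ _).
move=> /flattenP[q /mapP[r hr ->]]; rewrite inE => /orP[/eqP->|pir].
  rewrite inE => /orP[/eqP->|tr]; last exact/subi/(IH r).
  by rewrite /= eqxx sub0seq.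
move=> /(mem_extend_block pir)[tr|[t' t'r ->]]; first exact/subi/(IH r).
by rewrite /= eqxx (IH r).
Qed.

Lemma is_derive_block_product (i : 'I_d) u pi x :
  (forall t, t \in pi -> derivable (partial t u) x (delta_mx 0 i)) ->
  is_derive x (delta_mx 0 i) (fun y => \prod_(t <- pi) partial t u y)
    (\sum_(pi' <- extend_block i pi) \prod_(t <- pi') partial t u x).
Proof.
elim: pi => [|t pi IH] h /=.
  under eq_fun do rewrite big_nil; rewrite big_nil; exact: is_derive_cst.
under eq_fun do rewrite big_cons.
have h1 : derivable (partial t u) x (delta_mx 0 i) by apply: h; exact: mem_head.
have h2 := IH (fun r rp => h r (@mem_behead _ (t :: pi) r rp)).
have := is_deriveM (derivableP h1) h2.
move=> /is_derive_eq; apply.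
rewrite big_cons addrC big_map; congr (_ + _).
  by rewrite big_cons /= mulrC.
rewrite scaler_sumr; apply: eq_bigr => r _.
by rewrite big_cons.
Qed.

(** For each partition of [s], differentiating the outer factor creates the new block [[:: i]] and
    raises the order by one; differentiating the product adds [i] to one of the blocks. *)
Lemma is_derive_faa_di_bruno (c : nat -> R -> R) u s i x :
  (forall k, is_derive (u x) 1 (c k) (c k.+1 (u x))) ->
  (forall t, subseq t s -> derivable (partial t u) x (delta_mx 0 i)) ->
  is_derive x (delta_mx 0 i)
    (fun y => faa_di_bruno s (fun k => c k (u y)) (fun t => partial t u y))
    (faa_di_bruno (i :: s) (fun k => c k (u x)) (fun t => partial t u x)).
Proof.
move=> hc hu; rewrite /faa_di_bruno /=.
have : {subset set_partitions s <= [pred pi | all (subseq^~ s) pi]}.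
  by move=> pi hpi; apply/allP => t; exact: set_partitions_subseq hpi.
elim: (set_partitions s) => [|pi l IH] hl /=.
  under eq_fun do rewrite big_nil; rewrite big_nil; exact: is_derive_cst.
under eq_fun do rewrite big_cons.
rewrite big_cons big_cat /= addrA.
apply: is_deriveD; last by apply: IH => r rl; apply: hl; rewrite inE rl orbT.
have /allP hpi := hl pi (mem_head _ _).
have h1 := is_derive_block_product (fun t tp => hu t (hpi t tp)).
have hu0 : derivable u x (delta_mx 0 i) by apply: (hu [::]); exact: sub0seq.
have h2 := is_derive_comp_line (hc (size pi)) (derivableP hu0).
have := is_deriveM h2 h1; move=> /is_derive_eq; apply.
rewrite addrC big_cons /=; congr (_ + _).
  rewrite scaler_sumr big_seq [RHS]big_seq; apply: eq_bigr => r rp.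
  by rewrite (size_extend_block rp).
exact: etrans (mulrC _ _) (esym (mulrA _ _ _)).
Qed.

(** Existence and formula are proved together: the next derivative can be taken only if the formula
    holds on a neighbourhood. *)
Lemma partial_comp (c : nat -> R -> R) u s x :
  (forall k y, is_derive (y : R) 1 (c k) (c k.+1 y)) ->
  (forall t, subseq t s -> has_partial t u x) ->
  has_partial s (fun y => c 0%N (u y)) x /\
  partial s (fun y => c 0%N (u y)) x =
    faa_di_bruno s (fun k => c k (u x)) (fun t => partial t u x).
Proof.
move=> hc; elim: s x => [|i s IH] x hx.
  by rewrite /faa_di_bruno /= big_seq1 big_nil mulr1.
have hd t : subseq t s -> derivable (partial t u) x (delta_mx 0 i) /\
    \forall y \near x, has_partial t u y.
  by move=> ts; have [|] := hx (i :: t); rewrite /= ?eqxx.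
have hn : \forall y \near x, has_partial s (fun z => c 0%N (u z)) y /\
    partial s (fun z => c 0%N (u z)) y =
    faa_di_bruno s (fun k => c k (u y)) (fun t => partial t u y).
  have := near_subseq (nbhs_filter x) (fun t ts => (hd t ts).2).
  by apply: filterS => y; exact: IH.
have := is_derive_faa_di_bruno (fun k => hc k (u x)) (fun t ts => (hd t ts).1).
have ne : \forall y \near x, faa_di_bruno s (fun k => c k (u y)) (fun t => partial t u y) =
    partial s (fun z => c 0%N (u z)) y by apply: filterS hn => y [_ ->].
move=> /(near_eq_is_derive ne)[h1 h2]; split => //=; split => //.
by apply: filterS hn => y [].
Qed.

Lemma has_partial_near_eq s (f g : 'rV[R]_d -> R) x :
  (\forall y \near x, f y = g y) -> has_partial s f x ->
  has_partial s g x /\ partial s f x = partial s g x.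
Proof.
elim: s x => [|i s IH] x fg /=; first by move=> _; split => //; exact: (nbhs_singleton fg).
move=> [hn hd].
have fgn := near_join fg.
have h : \forall y \near x, has_partial s g y /\ partial s f y = partial s g y.
  by near=> y; apply: IH; near: y.
have e : \forall y \near x, partial s f y = partial s g y by apply: filterS h => y [].
split; first split.
- by apply: filterS h => y [].
- exact: near_eq_derivable e hd.
- exact: near_eq_derive.
Unshelve. all: by end_near. Qed.

Lemma faa_di_bruno_cvg s (c_ : nat -> nat -> R) (c : nat -> R)
    (p_ : nat -> seq 'I_d -> R) (p : seq 'I_d -> R) :
  (forall k, c_ n k @[n --> \oo] --> c k) ->
  (forall t, subseq t s -> p_ n t @[n --> \oo] --> p t) ->
  faa_di_bruno s (c_ n) (p_ n) @[n --> \oo] --> faa_di_bruno s c p.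
Proof.
move=> hc hp; rewrite /faa_di_bruno.
have : {subset set_partitions s <= [pred pi | all (subseq^~ s) pi]}.
  by move=> pi hpi; apply/allP => t; exact: set_partitions_subseq hpi.
elim: (set_partitions s) => [|pi l IH] hl.
  under eq_cvg do rewrite big_nil; rewrite big_nil; exact: cvg_cst.
under eq_cvg do rewrite big_cons; rewrite big_cons.
apply: cvgD; last by apply: IH => r rl; apply: hl; rewrite inE rl orbT.
apply: cvgM; first exact: hc.
have /allP := hl pi (mem_head _ _); elim: pi {IH hl} => [|t pi IH] hpi.
  under eq_cvg do rewrite big_nil; rewrite big_nil; exact: cvg_cst.
under eq_cvg do rewrite big_cons; rewrite big_cons.
apply: cvgM; first by apply: hp; apply: hpi; exact: mem_head.
by apply: IH => r rp; apply: hpi; rewrite inE rp orbT.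
Qed.

End faa_di_bruno.

(** * Derivatives of (1 + y/n)^n and their limit *)

Section power_exponential.
Context (R : realType).
Implicit Types (n k : nat) (y : R).

Definition power_deriv n k y : R :=
  (n ^_ k)%:R / n%:R ^+ k * (1 + n%:R^-1 * y) ^+ (n - k).

Lemma is_derive_power_deriv n k y :
  is_derive y 1 (power_deriv n k) (power_deriv n k.+1 y).
Proof.
have h1 : is_derive y 1 (fun z : R => 1 + n%:R^-1 * z) n%:R^-1.
  have := is_deriveD (is_derive_cst (1 : R) y 1) (is_deriveZ (n%:R^-1) (is_derive_id y 1)).
  by move=> /is_derive_eq; apply; rewrite add0r [_ *: _]mulr1.
rewrite /power_deriv subnS.
case nk : (n - k)%N => [|m].
  (* The truncated exponent n - k is harmless: the power is constant here, and the falling factorial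
     of order k + 1 vanishes. *)
  have kn : (n <= k)%N by rewrite -subn_eq0 nk.
  rewrite (@ffact_small n k.+1) ?ltnS// !mul0r.
  under eq_fun do rewrite expr0 mulr1; exact: is_derive_cst.
have := is_deriveZ ((n ^_ k)%:R / n%:R ^+ k) (is_deriveX m.+1 h1).
rewrite exprfctE => /is_derive_eq h2; apply: h2.
rewrite ffactnSr nk natrM exprSr invfM.
rewrite /GRing.scale/=; ring.
Qed.

Lemma natV_cvg0 : (n%:R^-1 : R) @[n --> \oo] --> (0 : R).
Proof.
apply/cvgrPdist_lt => e e0; near=> n; rewrite sub0r normrN ger0_norm//.
have en : e^-1 < n%:R by near: n; exact: nbhs_infty_gtr.
have n0 : 0 < n%:R :> R by apply: lt_trans en; rewrite invr_gt0.
by rewrite -[ltRHS]invrK ltf_pV2 ?posrE// invr_gt0.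
Unshelve. all: by end_near. Qed.

Lemma nat_subn_cvg k : ((n - k)%N%:R / n%:R : R) @[n --> \oo] --> (1 : R).
Proof.
have h : (1 - k%:R * n%:R^-1 : R) @[n --> \oo] --> (1 - k%:R * 0 : R).
  apply: cvgB; first exact: cvg_cst.
  apply: cvgM; first exact: cvg_cst.
  exact: natV_cvg0.
rewrite mulr0 subr0 in h; apply: cvg_trans h; apply: near_eq_cvg.
near=> n; have kn : (k <= n)%N by near: n; exists k.
have n0 : (0 < n)%N by near: n; exists 1%N.
by rewrite natrB// mulrBl divff// pnatr_eq0 -lt0n.
Unshelve. all: by end_near. Qed.

Lemma ffact_cvg k : ((n ^_ k)%:R / n%:R ^+ k : R) @[n --> \oo] --> (1 : R).
Proof.
elim: k => [|k IH].
  by under eq_cvg do rewrite ffactn0 expr0 divr1; exact: cvg_cst.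
under eq_cvg do rewrite ffactnSr natrM exprSr invfM mulrACA.
by have := cvgM IH (nat_subn_cvg k); rewrite mulr1; exact.
Qed.

(** Squeeze by exp(y/(1+y)) <= 1 + y <= exp(y) with y = u_n/n, raised to the power n. The lower
    bound is the upper one applied to -y/(1+y). *)
Lemma power_expR_cvg (u : nat -> R) v : u n @[n --> \oo] --> v ->
  (1 + n%:R^-1 * u n) ^+ n @[n --> \oo] --> expR v.
Proof.
move=> uv.
have n1 := natV_cvg0.
have h1 : 1 + n%:R^-1 * u n @[n --> \oo] --> (1 : R).
  have := cvgD (cvg_cst (1 : R)) (cvgM n1 uv); rewrite mul0r addr0; exact.
have hup : expR (u n) @[n --> \oo] --> expR v.
  by apply: continuous_cvg => //; exact: continuous_expR.
have hlo : expR (u n / (1 + n%:R^-1 * u n)) @[n --> \oo] --> expR v.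
  apply: continuous_cvg; first exact: continuous_expR.
  by rewrite -[X in _ --> X]divr1; apply: cvgM => //; apply: cvgV.
apply: (squeeze_cvgr _ hlo hup); near=> n.
have n0 : (0 < n)%N by near: n; exists 1%N.
have nn0 : n%:R != 0 :> R by rewrite pnatr_eq0 -lt0n.
have p0 : 0 < 1 + n%:R^-1 * u n by near: n; apply: (cvgr_gt 1).
pose y := n%:R^-1 * u n; rewrite -/y in p0 *; have un : u n = y * n%:R by rewrite /y; field.
apply/andP; split; last first.
  rewrite un.
  by rewrite expRM_natr; apply: lerXn2r; rewrite ?nnegrE ?expR_ge0 ?(ltW p0)// expR_ge1Dx.
rewrite un mulrAC.
rewrite expRM_natr; apply: lerXn2r; rewrite ?nnegrE ?expR_ge0 ?(ltW p0)//.
have : (1 + y)^-1 <= expR (- (y / (1 + y))).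
  apply: le_trans (expR_ge1Dx _); rewrite le_eqVlt; apply/orP; left; apply/eqP.
  by field; rewrite gt_eqF.
by rewrite expRN lef_pV2 ?posrE ?expR_gt0.
Unshelve. all: by end_near. Qed.

Lemma power_deriv_cvg k (u : nat -> R) v : u n @[n --> \oo] --> v ->
  power_deriv n k (u n) @[n --> \oo] --> expR v.
Proof.
move=> uv.
have n1 := natV_cvg0.
have h1 : 1 + n%:R^-1 * u n @[n --> \oo] --> (1 : R).
  have := cvgD (cvg_cst (1 : R)) (cvgM n1 uv); rewrite mul0r addr0; exact.
have h2 : (1 + n%:R^-1 * u n) ^+ k @[n --> \oo] --> (1 : R).
  elim: k => [|k IH]; first by under eq_cvg do rewrite expr0; exact: cvg_cst.
  under eq_cvg do rewrite exprS.
  by have := cvgM h1 IH; rewrite mulr1; exact.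
have h3 : (n ^_ k)%:R / n%:R ^+ k * ((1 + n%:R^-1 * u n) ^+ n *
    ((1 + n%:R^-1 * u n) ^+ k)^-1) @[n --> \oo] --> 1 * (expR v * 1^-1).
  apply: cvgM; first exact: ffact_cvg.
  by apply: cvgM; [exact: power_expR_cvg|apply: cvgV => //; exact: oner_neq0].
rewrite mul1r invr1 mulr1 in h3; apply: cvg_trans h3; apply: near_eq_cvg; near=> n.
have p0 : 0 < 1 + n%:R^-1 * u n by near: n; apply: (cvgr_gt 1).
have kn : (k <= n)%N by near: n; exists k.
rewrite /power_deriv; congr (_ * _).
by rewrite expfB_cond ?gt_eqF.
Unshelve. all: by end_near. Qed.

End power_exponential.

(** * Convergence of the derivatives under both assumptions *)

Section rescaled_partials.
Context (R : realType) (d : nat).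
Implicit Types (s t : seq 'I_d) (x y : 'rV[R]_d).

Lemma has_partialN s (f : 'rV[R]_d -> R) x : has_partial s f x ->
  has_partial s (fun y => - f y) x /\ partial s (fun y => - f y) x = - partial s f x.
Proof.
elim: s x => [//|i s IH] x /= [hn hd].
have h : \forall y \near x, has_partial s (fun y => - f y) y /\
    - partial s f y = partial s (fun y => - f y) y.
  by apply: filterS hn => y /IH[? ->].
have e : \forall y \near x, - partial s f y = partial s (fun y => - f y) y.
  by apply: filterS h => y [].
have [h1 h2] := near_eq_is_derive e (is_deriveN (derivableP hd)).
by split => //; split => //; apply: filterS h => y [].
Qed.

(** A duplicate-free [s] has at most d entries. Padding it with further, outer derivatives up to
    order d is allowed because indices may repeat. *)
Lemma has_partials_uniq (f : 'rV[R]_d -> R) (A : set 'rV[R]_d) s x : (0 < d)%N ->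
  has_partials_of_order d f A -> uniq s -> A x -> has_partial s f x.
Proof.
move=> d0 hf us Ax; apply: (@has_partial_cat _ _ (nseq (d - size s) (Ordinal d0))).
apply: hf => //; rewrite size_cat size_nseq subnK//.
by rewrite -[leqRHS](card_ord d) -(card_uniqP us) max_card.
Qed.


Variables (N C nrm : 'rV[R]_d -> R).
Hypotheses (hN : is_norm N) (hnrm : is_norm nrm).

Lemma one_sub_rescale n x : (const_mx 1 : 'rV[R]_d) - (const_mx 1 + n%:R^-1 *: x) =
  - n%:R^-1 *: x.
Proof. by rewrite opprD addrA subrr add0r scaleNr. Qed.

Lemma neg_orthant_near x : neg_orthant x -> \forall y \near x, neg_orthant y.
Proof.
move=> hx; apply: (@filter_forall _ _ (fun (j : 'I_d) y => y 0 j < 0) (nbhs x) (nbhs_filter x)).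
move=> j; have := @coord_continuous R 1 d 0 j x.
by move=> /cvgr_lt; apply; exact: hx.
Qed.

(** For large n a whole neighbourhood of x is mapped into the cube where C is explicit; by
    homogeneity the rescaled copula is -N there, so all derivatives agree as well. *)
Lemma pareto_rescaled x : is_generalized_Pareto C N -> neg_orthant x ->
  \forall n \near \oo, \forall y \near x, - N y = rescaled_copula C n y.
Proof.
move=> [u0 [hu0 hC]] hx.
(* This n puts 1 + (x_j - 1)/n above u0_j; the extra 1 is the room for the neighbours y with y_j >
   x_j - 1. *)
have hn : \forall n \near \oo, forall j : 'I_d, (1 - x 0 j) / (1 - u0 0 j) < n%:R.
  apply: filter_forall => j; exact: nbhs_infty_gtr.
near=> n.
have n0 : 0 < n%:R :> R by rewrite ltr0n; near: n; exists 1%N.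
have hnj : forall j : 'I_d, (1 - x 0 j) / (1 - u0 0 j) < n%:R by near: n.
have hy : \forall y \near x, forall j : 'I_d, x 0 j - 1 < (y : 'rV[R]_d) 0 j.
  apply: (@filter_forall _ _ (fun (j : 'I_d) y => x 0 j - 1 < y 0 j) (nbhs x) (nbhs_filter x)).
  move=> j; have := @coord_continuous R 1 d 0 j x.
  by move=> /cvgr_gt; apply; rewrite ltrBlDr ltrDl.
have hneg := neg_orthant_near hx.
near=> y.
have yneg : neg_orthant y by near: y.
have yx : forall j : 'I_d, x 0 j - 1 < y 0 j by near: y.
rewrite /rescaled_copula hC; last first.
  move=> j; rewrite !mxE; have /andP[_ u1] := hu0 j.
  have u1' : 0 < 1 - u0 0 j by rewrite subr_gt0.
  have := hnj j; rewrite ltr_pdivrMr// => h1; have := yx j => h2.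
  apply/andP; split; last first.
    by rewrite gerDl pmulr_rle0 ?invr_gt0//; exact/ltW/yneg.
  rewrite -(@ler_pM2l _ n%:R)// mulrDr mulrA divff ?gt_eqF// mul1r mulr1; lra.
rewrite one_sub_rescale (is_normZ hN) normrN ger0_norm ?invr_ge0 ?ltW//.
by field; rewrite gt_eqF.
Unshelve. all: by end_near. Qed.

Lemma rescale_cvg1 x : const_mx 1 + n%:R^-1 *: x @[n --> \oo] --> (const_mx 1 : 'rV[R]_d).
Proof.
have : const_mx 1 + n%:R^-1 *: x @[n --> \oo] --> (const_mx 1 : 'rV[R]_d) + 0 *: x.
  apply: cvgD; first exact: cvg_cst.
  by apply: cvgZ; [exact: natV_cvg0|exact: cvg_cst].
by rewrite scale0r addr0.
Qed.

Lemma expansion_rescaled x : copula_expansion C N nrm -> neg_orthant x ->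
  rescaled_copula C n x @[n --> \oo] --> - N x.
Proof.
move=> /eqoP hexp hx.
have nrm0 y : 0 <= nrm y.
  have h0 : nrm 0 = 0 by rewrite -(scale0r (0 : 'rV[R]_d)) (is_normZ hnrm) normr0 mul0r.
  have := is_normD hnrm y (- y); rewrite subrr h0 -scaleN1r (is_normZ hnrm) normrN1 mul1r.
  by lra.
apply/cvgrPdist_le => e e0.
(* By homogeneity the final error is e times nrm x / (nrm x + 1), which is at most e. *)
have e'0 : 0 < e / (nrm x + 1) by rewrite divr_gt0// ltr_wpDl.
have hcube : \forall n \near \oo, unit_cube (const_mx 1 + n%:R^-1 *: x).
  have hn : \forall n \near \oo, forall j : 'I_d, - x 0 j < n%:R.
    by apply: filter_forall => j; exact: nbhs_infty_gtr.
  near=> n; have n0 : 0 < n%:R :> R by rewrite ltr0n; near: n; exists 1%N.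
  have hnj : forall j : 'I_d, - x 0 j < n%:R by near: n.
  move=> j; rewrite !mxE; apply/andP; split; last first.
    by rewrite gerDl pmulr_rle0 ?invr_gt0//; exact/ltW/hx.
  rewrite -(@ler_pM2l _ n%:R)// mulrDr mulrA divff ?gt_eqF// mul1r mulr1 mulr0.
  by have := hnj j; lra.
have hev := @rescale_cvg1 x _ (hexp _ e'0).
near=> n.
have n0 : 0 < n%:R :> R by rewrite ltr0n; near: n; exists 1%N.
have cu : unit_cube (const_mx 1 + n%:R^-1 *: x) by near: n.
have : unit_cube (const_mx 1 + n%:R^-1 *: x) ->
  `|C (const_mx 1 + n%:R^-1 *: x) - (1 - N (const_mx 1 - (const_mx 1 + n%:R^-1 *: x)))|
  <= e / (nrm x + 1) * `|nrm (const_mx 1 - (const_mx 1 + n%:R^-1 *: x))|.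
  by near: n.
move=> /(_ cu) h; rewrite one_sub_rescale (is_normZ hN) (is_normZ hnrm) normrN in h.
have ninv : `|n%:R^-1| = n%:R^-1 :> R by rewrite ger0_norm.
rewrite ninv normrM ninv (ger0_norm (nrm0 x)) in h.
rewrite -(ler_pM2l n0) -[X in X * `|_|](gtr0_norm n0) -normrM in h.
rewrite distrC /rescaled_copula.
have -> : n%:R * (C (const_mx 1 + n%:R^-1 *: x) - 1) - - N x =
  n%:R * (C (const_mx 1 + n%:R^-1 *: x) - (1 - n%:R^-1 * N x)) by field; rewrite gt_eqF.
apply: (le_trans h).
have -> : n%:R * (e / (nrm x + 1) * (n%:R^-1 * nrm x)) = e * (nrm x / (nrm x + 1)).
  by field; rewrite !gt_eqF// ltr_wpDl.
apply: ler_piMr; first exact: ltW.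
by rewrite ler_pdivrMr ?ltr_wpDl// mul1r lerDl.
Unshelve. all: by end_near. Qed.

Hypothesis hN' : has_partials_of_order d N neg_orthant.
Hypothesis d0 : (0 < d)%N.
Hypothesis hab : is_generalized_Pareto C N \/
  (copula_expansion C N nrm /\ copula_derivatives_converge C N).

Lemma rescaled_copula_partials s x : uniq s -> neg_orthant x ->
  (\forall n \near \oo, has_partial s (rescaled_copula C n) x) /\
  partial s (rescaled_copula C n) x @[n --> \oo] --> partial s (fun y => - N y) x.
Proof.
move=> us hx; have [hNs _] := has_partialN (has_partials_uniq d0 hN' us hx).
case: hab => [hp|[he hd]].
  have h : \forall n \near \oo, has_partial s (rescaled_copula C n) x /\
      partial s (fun y => - N y) x = partial s (rescaled_copula C n) x.
    have := pareto_rescaled hp hx; apply: filterS => n hn.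
    exact: has_partial_near_eq hn hNs.
  split; first by apply: filterS h => n [].
  apply: cvg_near_cst; apply: filterS h => n [_ ->] //.
(* The derivative assumption speaks of nonempty index sets; convergence of the function itself comes
   from the expansion. *)
have [->|s0] := eqVneq s [::]; last exact: hd.
by split; [exact: nearW|exact: expansion_rescaled].
Qed.

Lemma copula_power_partials s x : uniq s -> neg_orthant x ->
  [/\ has_partial s (fun y => expR (- N y)) x,
      \forall n \near \oo,
        has_partial s (fun y => C (const_mx 1 + n%:R^-1 *: y) ^+ n) x &
      partial s (fun y => C (const_mx 1 + n%:R^-1 *: y) ^+ n) x @[n --> \oo] -->
        partial s (fun y => expR (- N y)) x].
Proof.
move=> us hx.
have hsub t : subseq t s -> uniq t by move=> ts; exact: subseq_uniq us.
have hNt t : subseq t s -> has_partial t (fun y => - N y) x.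
  by move=> /hsub ut; have [] := has_partialN (has_partials_uniq d0 hN' ut hx).
have [hG hGe] := @partial_comp R d (fun=> expR) (fun y => - N y) s x
  (fun _ z => is_derive_expR z) hNt.
have hpow n y : (0 < n)%N ->
    power_deriv n 0 (rescaled_copula C n y) = C (const_mx 1 + n%:R^-1 *: y) ^+ n.
  move=> n0; rewrite /power_deriv ffactn0 expr0 divr1 mul1r subn0 /rescaled_copula.
  by rewrite mulrA mulVf ?pnatr_eq0 -?lt0n// mul1r addrC subrK.
have hev : \forall n \near \oo, forall t, subseq t s -> has_partial t (rescaled_copula C n) x.
  apply: near_subseq => t ts.
  by have [] := rescaled_copula_partials (hsub t ts) hx.
have hH : \forall n \near \oo,
    has_partial s (fun y => C (const_mx 1 + n%:R^-1 *: y) ^+ n) x /\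
    faa_di_bruno s (fun k => power_deriv n k (rescaled_copula C n x))
      (fun t => partial t (rescaled_copula C n) x) =
    partial s (fun y => C (const_mx 1 + n%:R^-1 *: y) ^+ n) x.
  near=> n; have n0 : (0 < n)%N by near: n; exists 1%N.
  have hn : forall t, subseq t s -> has_partial t (rescaled_copula C n) x by near: n.
  have [h1 h2] := @partial_comp R d (power_deriv n) (rescaled_copula C n) s x
    (is_derive_power_deriv n) hn.
  have e : (fun y => power_deriv n 0 (rescaled_copula C n y)) =
      (fun y => C (const_mx 1 + n%:R^-1 *: y) ^+ n).
    by apply/funext => y; exact: hpow.
  by rewrite e in h1 h2.
split => //; first by apply: filterS hH => n [].
rewrite hGe.
have : faa_di_bruno s (fun k => power_deriv n k (rescaled_copula C n x))
      (fun t => partial t (rescaled_copula C n) x) @[n --> \oo] -->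
    faa_di_bruno s (fun=> expR (- N x)) (fun t => partial t (fun y => - N y) x).
  apply: faa_di_bruno_cvg => [k|t ts].
    apply: power_deriv_cvg.
    by have [_] := rescaled_copula_partials (isT : uniq (Nil 'I_d)) hx.
  by have [_] := rescaled_copula_partials (hsub t ts) hx.
apply: cvg_trans; apply: near_eq_cvg; apply: filterS hH => n [_ ->] //.
Unshelve. all: by end_near. Qed.

End rescaled_partials.

(** * Laws of the maxima and of the quantile vector *)

Section quantile_function.
Context (R : realType) (dT : measure_display) (T : measurableType dT) (P : probability T R).
Variable X : {RV P >-> R}.
Local Notation F := (marginal_cdf X).

Lemma marginal_cdfE t : (F t)%:E = cdf X t.
Proof. by rewrite /marginal_cdf fineK// fin_num_measure. Qed.

Lemma marginal_cdf_nondecreasing : {homo F : t s / t <= s}.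
Proof. by move=> t s ts; rewrite -lee_fin !marginal_cdfE; exact: cdf_nondecreasing. Qed.

(** Right continuity makes the infimum a minimum. The set is nonempty because q < 1 and bounded
    below because q > 0, by the limits of F at both infinities. *)
Lemma quantile_le c q t : 0 < q < 1 -> (quantile F c q <= t) = (q <= F t).
Proof.
move=> /[dup] q01 /andP[q0 q1]; rewrite /quantile q01.
set S := [set t | q <= F t].
have S_up s s' : S s -> s <= s' -> S s'.
  by move=> Ss ss'; apply: (le_trans Ss); exact: marginal_cdf_nondecreasing.
have Sn0 : S !=set0.
  have /fine_cvgP[_] := cvg_cdfy1 X.
  move=> /cvgr_gt/(_ q q1)[M [_ hM]]; exists (M + 1).
  by apply/ltW/hM; rewrite ltrDl.
have [l hl] : exists l, F l < q.
  have /fine_cvgP[_] := cvg_cdfNy0 X.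
  move=> /cvgr_lt/(_ q q0)[M [_ hM]]; exists (M - 1).
  by apply: hM; rewrite ltrBlDr ltrDl.
have Slb : has_lbound S.
  exists l => s Ss; rewrite leNgt; apply/negP => sl.
  by have := S_up _ _ Ss (ltW sl); rewrite /S /= leNgt hl.
have Sinf : q <= F (inf S).
  have hr : F r @[r --> (inf S)^'+] --> F (inf S).
    have := @cdf_right_continuous _ _ _ P X (inf S).
    by rewrite -marginal_cdfE => /fine_cvgP[].
  rewrite -(cvg_lim _ hr)//; apply: limr_ge; first by apply/cvg_ex; exists (F (inf S)).
  near=> r; have ir : inf S < r by near: r; exact: nbhs_right_gt.
  have [s Ss sr] := inf_lt Sn0 ir.
  exact: S_up Ss (ltW sr).
apply/idP/idP => [h|h]; last exact: ge_inf.
by apply: (le_trans Sinf); exact: marginal_cdf_nondecreasing.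
Unshelve. all: by end_near. Qed.

Lemma measurable_quantile c : measurable_fun setT (quantile F c).
Proof.
apply: (@measurability _ _ _ _ _ _ _ (RGenOInfty.measurableE R)) => _ [_ [a ->] <-].
rewrite setTI.
have -> : quantile F c @^-1` `]a, +oo[%classic =
    (`]0, 1[%classic `&` `]F a, +oo[%classic) `|`
    (~` `]0, 1[%classic `&` (if a < c then setT else set0)).
  apply/seteqP; split => q; rewrite /= !in_itv/= !andbT.
    have [q01|q01] := boolP (0 < q < 1).
      by rewrite ltNge quantile_le// -ltNge => h; left.
    rewrite /quantile (negbTE q01) => ac; right; rewrite ac; split => //.
  move=> [[q01 h]|[q01]]; first by rewrite ltNge quantile_le// -ltNge.
  by case: ifPn => // ac _; rewrite /quantile ifN//; apply/negP => h; exact: q01.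
apply: measurableU; first exact: measurableI.
by apply: measurableI; [exact: measurableC|case: ifP].
Qed.

End quantile_function.

Section laws.
Context (R : realType) (d : nat).
Implicit Types (x : 'rV[R]_d).

Lemma lower_orthant_cover :
  \bigcup_n lower_orthant (const_mx n%:R : 'rV[R]_d) = [set: 'rV[R]_d].
Proof.
apply/seteqP; split => // x _.
have [n _ hn] : \forall n \near \oo, forall j : 'I_d, x 0 j < n%:R.
  by apply: filter_forall => j; exact: nbhs_infty_gtr.
by exists n => // j; rewrite mxE; apply/ltW/(hn n (leqnn n)).
Qed.

Lemma measure_lower_orthant_unique (m1 m2 : {measure set 'rV[R]_d -> \bar R}) :
  (m1 setT < +oo)%E ->
  (forall x, m1 (lower_orthant x) = m2 (lower_orthant x)) ->
  forall A, measurable A -> m1 A = m2 A.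
Proof.
move=> m1oo m12; pose G : set (set 'rV[R]_d) := range (@lower_orthant R d).
have Gm A : G A -> measurable A by move=> [x _ <-]; exact: measurable_lower_orthant.
apply: (@measure_unique _ _ _ G (fun n => lower_orthant (const_mx n%:R))).
- apply/seteqP; split => A; last first.
    by move: A; apply: smallest_sub; [exact: sigma_algebra_measurable|exact: Gm].
  move=> mA; pose T := g_sigma_algebraType G.
  suff mid : measurable_fun [set: T] (fun x : T => x : 'rV[R]_d).
    by have := mid measurableT A mA; rewrite setTI.
  apply: measurable_rV => i.
  apply: (@measurability _ _ _ _ _ _ _ (RGenOInfty.measurableE R)) => _ [_ [a ->] <-].
  rewrite setTI.
  have -> : (fun x : 'rV[R]_d => x 0 i) @^-1` `]a, +oo[%classic =
      ~` \bigcup_n lower_orthant (\row_j (if j == i then a else n%:R)).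
    apply/seteqP; split => x; rewrite /= in_itv/= andbT.
      by move=> ax [n _ /(_ i)]; rewrite mxE eqxx leNgt ax.
    move=> h; rewrite ltNge; apply/negP => xa; apply: h.
    have [n _ hx] : (\bigcup_n lower_orthant (const_mx n%:R : 'rV[R]_d)) x.
      by rewrite lower_orthant_cover.
    exists n => // j; rewrite mxE; case: eqP => [->//|_].
    by have := hx j; rewrite mxE.
  apply: (@measurableC _ T); apply: (@bigcupT_measurable _ T) => n.
  by apply: sub_sigma_algebra; eexists.
- move=> _ _ [x _ <-] [y _ <-]; exists (\row_j Num.min (x 0 j) (y 0 j)) => //.
  apply/seteqP; split => z.
    by move=> h; split => j; have := h j; rewrite mxE le_min => /andP[].
  by move=> [hx hy] j; rewrite mxE le_min hx hy.
- by move=> n; eexists.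
- exact: lower_orthant_cover.
- by move=> _ [x _ <-]; exact: m12.
- move=> n; apply: le_lt_trans m1oo; apply: le_measure; rewrite ?inE//.
  exact: measurable_lower_orthant.
Qed.

Lemma measurable_rvec dT (T : measurableType dT) (P : probability T R)
    (X : 'I_d -> {RV P >-> R}) : measurable_fun setT (rvec X).
Proof. by apply: measurable_rV => i; under eq_fun do rewrite mxE; exact: measurable_funP. Qed.

Definition law dT (T : measurableType dT) (P : probability T R) (f : T -> 'rV[R]_d)
    (mf : measurable_fun setT f) : probability 'rV[R]_d R :=
  distribution P (mfun_Sub (mem_set mf)).

Lemma lawE dT (T : measurableType dT) (P : probability T R) (f : T -> 'rV[R]_d)
  (mf : measurable_fun setT f) A : law P mf A = P (f @^-1` A).
Proof. by []. Qed.

Lemma law_setT dT (T : measurableType dT) (P : probability T R) (f : T -> 'rV[R]_d)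
  (mf : measurable_fun setT f) : law P mf setT = 1%E.
Proof. by rewrite lawE preimage_setT probability_setT. Qed.

Lemma joint_cdfE dT (T : measurableType dT) (P : probability T R)
    (X : 'I_d -> {RV P >-> R}) x :
  P (rvec X @^-1` lower_orthant x) = (joint_cdf X x)%:E.
Proof.
have -> : rvec X @^-1` lower_orthant x = [set w | forall j, X j w <= x 0 j].
  by apply/seteqP; split => w h j; have := h j; rewrite mxE.
rewrite fineK// fin_num_measure//.
have -> : [set w | forall j, X j w <= x 0 j] = rvec X @^-1` lower_orthant x.
  by apply/seteqP; split => w h j; have := h j; rewrite mxE.
rewrite -[X in measurable X]setTI; apply: measurable_rvec => //.
exact: measurable_lower_orthant.
Qed.

Lemma uniform_prob_open01 : uniform_prob (@ltr01 R) `]0, 1[%classic = 1%E.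
Proof.
rewrite /uniform_prob integral_uniform_pdf.
have -> : `]0, 1[%classic `&` `[0, 1]%classic = `]0, 1[%classic :> set R.
  by apply/setIidl => z /=; rewrite !in_itv/= => /andP[h1 h2]; rewrite !ltW.
rewrite (eq_integral (cst 1%E)); last first.
  move=> z; rewrite inE/= in_itv/= => /andP[h1 h2].
  by rewrite /uniform_pdf !ltW// subr0 invr1.
by rewrite integral_cst//= lebesgue_measure_itv/= lte_fin ltr01 -EFinB subr0 mule1.
Qed.

Lemma measurable_bigmax dT (T : measurableType dT) (I : Type) (r : seq I)
    (f0 : T -> R) (f : I -> T -> R) :
  measurable_fun setT f0 -> (forall i, measurable_fun setT (f i)) ->
  measurable_fun setT (fun w => \big[Num.max/f0 w]_(i <- r) f i w).
Proof.
move=> mf0 mf; elim: r => [|i r IH]; first by under eq_fun do rewrite big_nil.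
by under eq_fun do rewrite big_cons; exact: measurable_maxr.
Qed.

Lemma measurable_rescaled_cube n :
  measurable [set x : 'rV[R]_d | forall j, 0 < 1 + n%:R^-1 * x 0 j < 1].
Proof.
have -> : [set x : 'rV[R]_d | forall j, 0 < 1 + n%:R^-1 * x 0 j < 1] =
    [set x | forall j, ((fun r => 1 + n%:R^-1 * r) @^-1` `]0, 1[%classic) (x 0 j)].
  by apply/seteqP; split => x h j; have := h j; rewrite /= in_itv.
apply: (@measurable_rectangle _ _
  (fun=> (fun r : R => 1 + n%:R^-1 * r) @^-1` `]0, 1[%classic)) => _.
rewrite -[X in measurable X]setTI.
by apply: measurable_funD => //; exact: measurable_funM.
Qed.

Lemma measure_setI_full (mu : {measure set 'rV[R]_d -> \bar R}) S A :
  mu setT = 1%E -> measurable S -> mu S = 1%E -> measurable A -> mu A = mu (A `&` S).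
Proof.
move=> mu1 mS muS mA.
have fin B : measurable B -> mu B \is a fin_num.
  move=> mB; rewrite ge0_fin_numE//; apply: (@le_lt_trans _ _ (mu setT)).
    by apply: le_measure; rewrite ?inE.
  by rewrite mu1 ltry.
have cS0 : mu (~` S) = 0%E.
  have : mu (S `|` ~` S) = (mu S + mu (~` S))%E.
    by rewrite measureU//; [exact: measurableC|rewrite setICr].
  rewrite setUv mu1 muS -(fineK (fin _ (measurableC mS))) -EFinD => -[h].
  by congr EFin; lra.
have -> : mu A = (mu (A `&` S) + mu (A `&` ~` S))%E.
  rewrite -measureU; [by rewrite -setIUr setUv setIT| exact: measurableI| |].
    by apply: measurableI => //; exact: measurableC.
  by rewrite setIACA setICr setI0.
have : (mu (A `&` ~` S) <= mu (~` S))%E.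
  by apply: le_measure; rewrite ?inE//; [apply: measurableI|]; rewrite ?mA//; exact: measurableC.
by rewrite cS0 => h; rewrite (_ : mu (A `&` ~` S) = 0%E) ?adde0//; apply/eqP; rewrite eq_le h measure_ge0.
Qed.

(** The law of n(V - 1), with V the maximum of n independent copies of a vector with distribution
    function C. The second clause keeps the quantile map away from its default value. *)
Lemma copula_max_law (C : 'rV[R]_d -> R) n : is_copula C -> (0 < n)%N ->
  exists mu : probability 'rV[R]_d R,
  (forall x, mu (lower_orthant x) = (C (const_mx 1 + n%:R^-1 *: x) ^+ n)%:E) /\
  mu [set x | forall j, 0 < 1 + n%:R^-1 * x 0 j < 1] = 1%E.
Proof.
move=> [dU [OU [PU [U [hU ->]]]]]; case: n => // n _.
have [dn [On [Pn [pi [mpi hpi]]]]] := iid_copies PU n.+1.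
pose V (j : 'I_d) w := \big[Num.max/U j (pi ord0 w)]_(i < n.+1) U j (pi i w).
have Vle j w r : (V j w <= r) <-> forall i, U j (pi i w) <= r.
  split => [/bigmax_leP[_ h] i|h]; first exact: h.
  by apply/bigmax_leP; split => // i _; exact: h.
have mV j : measurable_fun setT (V j).
  apply: measurable_bigmax => [|i];
    by apply: measurableT_comp => //; exact: measurable_funP.
pose Z w : 'rV[R]_d := \row_j (n.+1%:R * (V j w - 1)).
have mZ : measurable_fun setT Z.
  apply: measurable_rV => j; under eq_fun do rewrite mxE.
  by apply: measurable_funM => //; exact: measurable_funB.
have n0 : 0 < n.+1%:R :> R by rewrite ltr0n.
exists (law Pn mZ); split.
  move=> x; rewrite lawE.
  have -> : Z @^-1` lower_orthant x = [set w | forall i,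
      (rvec U @^-1` lower_orthant (const_mx 1 + n.+1%:R^-1 *: x)) (pi i w)].
    have e j r : (n.+1%:R * (r - 1) <= x 0 j) = (r <= 1 + n.+1%:R^-1 * x 0 j).
      by rewrite -ler_pdivlMl// lerBlDl.
    apply/seteqP; split => w.
      move=> h i j; rewrite !mxE; have := h j; rewrite mxE e => /Vle; exact.
    by move=> h j; rewrite mxE e; apply/Vle => i; have := h i j; rewrite !mxE.
  rewrite (hpi (fun=> rvec U @^-1` lower_orthant (const_mx 1 + n.+1%:R^-1 *: x))).
    under eq_bigr do rewrite joint_cdfE.
    by rewrite prodEFin prodr_const card_ord.
  move=> _; rewrite -[X in measurable X]setTI; apply: measurable_rvec => //.
  exact: measurable_lower_orthant.
pose S := [set w | forall j, `]0, 1[%classic (U j w)].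
have mS : measurable S.
  have -> : S = \bigcap_(j in [set: 'I_d]) (U j @^-1` `]0, 1[%classic).
    by apply/seteqP; split => w h j => [_|]; exact: h.
  apply: fin_bigcap_measurable => // j _.
  by rewrite -[X in measurable X]setTI; exact: measurable_funP.
have PS : PU S = 1%E.
  have [A [mA A0 SA]] : \forall w \ae PU, forall j, `]0, 1[%classic (U j w).
    apply: filter_forall => j; exists (~` (U j @^-1` `]0, 1[%classic)); split => //.
      by apply: measurableC; rewrite -[X in measurable X]setTI; exact: measurable_funP.
    rewrite probability_setC; last first.
      by rewrite -[X in measurable X]setTI; exact: measurable_funP.
    have := hU j `]0, 1[%classic (measurable_itv _); rewrite uniform_prob_open01.
    by rewrite /distribution /pushforward => ->; rewrite subee.
  have : PU (~` S) = 0%E.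
    apply/eqP; rewrite eq_le measure_ge0 andbT -A0.
    by apply: le_measure; rewrite ?inE//; exact: measurableC.
  have fS : PU S \is a fin_num by rewrite fin_num_measure.
  by rewrite probability_setC// -(fineK fS) -EFinB => -[h]; congr EFin; lra.
have mT := measurable_rescaled_cube n.+1.
apply/eqP; rewrite eq_le; apply/andP; split.
  by rewrite -(law_setT Pn mZ); apply: le_measure; rewrite ?inE.
have -> : 1%E = Pn [set w | forall i, S (pi i w)].
  rewrite (hpi (fun=> S)) //.
  by under eq_bigr do rewrite PS; rewrite big1.
rewrite lawE; apply: le_measure; rewrite ?inE.
- have -> : [set w | forall i, S (pi i w)] = \bigcap_(i in [set: 'I_n.+1]) (pi i @^-1` S).
    by apply/seteqP; split => w h i => [_|]; exact: h.
  apply: fin_bigcap_measurable => // i _.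
  by rewrite -[X in measurable X]setTI; exact: mpi.
- by rewrite -[X in measurable X]setTI; exact: mZ.
move=> w h j; rewrite mxE mulrA mulVf ?gt_eqF// mul1r addrC subrK.
apply/andP; split.
  rewrite ltNge; apply/negP => /Vle/(_ ord0).
  by have := h ord0 j; rewrite /= in_itv/= => /andP[h1 _]; rewrite leNgt h1.
(* The maximum is attained, so the strict bound by 1 passes to it. *)
have : exists i : 'I_n.+1, V j w = U j (pi i w).
  rewrite /V; apply: (big_ind (fun r => exists i : 'I_n.+1, r = U j (pi i w))).
  - by exists ord0.
  - move=> r r' [i ->] [i' ->]; case: leP => _; [by exists i'|by exists i].
  - by move=> i _; exists i.
by move=> [i ->]; have := h i j; rewrite /= in_itv/= => /andP[].
Qed.

End laws.

Section maxima_law.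
Context (R : realType) (d : nat).
Context (dX : measure_display) (OX : measurableType dX) (PX : probability OX R).
Variables (X : 'I_d -> {RV PX >-> R}) (C : 'rV[R]_d -> R).
Hypothesis hXC : has_copula X C.

Lemma measurable_quantile_map (c : 'I_d -> R) n :
  measurable_fun setT (fun x : 'rV[R]_d =>
    \row_j quantile (marginal_cdf (X j)) (c j) (1 + n%:R^-1 * x 0 j)).
Proof.
apply: measurable_rV => i; under eq_fun do rewrite mxE.
apply: (measurableT_comp (measurable_quantile (X i) (c i))).
apply: measurable_funD => //; apply: measurable_funM => //.
exact: measurable_coord.
Qed.

(** On the full-measure set where the quantiles are genuine, [quantile_le] turns the preimage of the
    orthant at x into the orthant at y, y_j = n(F_j(x_j) - 1); there the n-th power of C is that of
    the joint distribution function. *)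
Lemma quantile_map_law (c : 'I_d -> R) n (mu : {measure set 'rV[R]_d -> \bar R}) x :
  (0 < n)%N -> mu setT = 1%E ->
  (forall x, mu (lower_orthant x) = (C (const_mx 1 + n%:R^-1 *: x) ^+ n)%:E) ->
  mu [set x : 'rV[R]_d | forall j, 0 < 1 + n%:R^-1 * x 0 j < 1] = 1%E ->
  mu ((fun x : 'rV[R]_d =>
    \row_j quantile (marginal_cdf (X j)) (c j) (1 + n%:R^-1 * x 0 j)) @^-1`
      lower_orthant x) = (joint_cdf X x ^+ n)%:E.
Proof.
move=> n0 mu1 muC muS; have mS := @measurable_rescaled_cube R d n.
have nn0 : 0 < n%:R :> R by rewrite ltr0n.
have mq : measurable ((fun x : 'rV[R]_d =>
    \row_j quantile (marginal_cdf (X j)) (c j) (1 + n%:R^-1 * x 0 j)) @^-1`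
      lower_orthant x).
  rewrite -[X in measurable X]setTI; apply: measurable_quantile_map => //.
  exact: measurable_lower_orthant.
pose y : 'rV[R]_d := \row_j (n%:R * (marginal_cdf (X j) (x 0 j) - 1)).
rewrite (measure_setI_full mu1 mS muS mq).
have -> : (fun x : 'rV[R]_d =>
    \row_j quantile (marginal_cdf (X j)) (c j) (1 + n%:R^-1 * x 0 j)) @^-1`
      lower_orthant x `&` [set x : 'rV[R]_d | forall j, 0 < 1 + n%:R^-1 * x 0 j < 1] =
    lower_orthant y `&` [set x : 'rV[R]_d | forall j, 0 < 1 + n%:R^-1 * x 0 j < 1].
  have e z j : 0 < 1 + n%:R^-1 * z < 1 ->
      (quantile (marginal_cdf (X j)) (c j) (1 + n%:R^-1 * z) <= x 0 j) = (z <= y 0 j).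
    by move=> z01; rewrite quantile_le// mxE -ler_pdivrMl// lerBrDl.
  by apply/seteqP; split => z [h hS]; split => // j; have := h j; rewrite mxE e.
rewrite -(measure_setI_full mu1 mS muS (measurable_lower_orthant y)) muC hXC.
congr (C _ ^+ n)%:E; apply/rowP => j; rewrite !mxE mulrA mulVf ?gt_eqF// mul1r.
by rewrite addrC subrK.
Qed.

Context (dO : measure_display) (Om : measurableType dO) (P : probability Om R).
Variable Xs : nat -> 'I_d -> {RV P >-> R}.
Hypothesis hXs_law : forall i, equal_in_law (Xs i) X.
Hypothesis hXs_ind : independent_vectors Xs.

Lemma measurable_maxima n : measurable_fun setT (maxima Xs n).
Proof.
apply: measurable_rV => j; under eq_fun do rewrite mxE.
by apply: measurable_bigmax => [|i]; exact: measurable_funP.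
Qed.

Lemma maxima_lower_orthant n x : (0 < n)%N ->
  P (maxima Xs n @^-1` lower_orthant x) = (joint_cdf X x ^+ n)%:E.
Proof.
move=> n0.
have -> : maxima Xs n @^-1` lower_orthant x =
    \bigcap_(i in [set` [fset i in iota 0 n]%fset]) (rvec (Xs i) @^-1` lower_orthant x).
  apply/seteqP; split => w.
    move=> h i; rewrite /= !inE mem_iota add0n => /= ni j.
    have := h j; rewrite !mxE => /bigmax_leP[_ /(_ (Ordinal ni) isT)].
    exact.
  move=> h j; rewrite mxE.
  have hi i : (i < n)%N -> Xs i j w <= x 0 j.
    move=> ni; have := h i; rewrite /= !inE mem_iota add0n => /(_ ni j).
    by rewrite mxE.
  by apply/bigmax_leP; split => [|i _]; exact: hi.
rewrite (hXs_ind _ (A := fun=> lower_orthant x)); last first.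
  by move=> _; exact: measurable_lower_orthant.
rewrite (eq_bigr (fun=> (joint_cdf X x)%:E)); last first.
  move=> i _; rewrite hXs_law ?joint_cdfE//; exact: measurable_lower_orthant.
rewrite prodEFin; congr EFin.
rewrite big_const_seq count_predT iter_mulr_1.
by rewrite card_fseq undup_id ?iota_uniq// size_iota.
Qed.

End maxima_law.

(** The orthants with corner -r(1,...,1) lie in the open orthant and have mass exp(-r N(1,...,1)),
    which tends to 1 as r decreases to 0. *)
Lemma law_neg_orthant (R : realType) (d : nat) (N : 'rV[R]_d -> R)
    (nu : {measure set 'rV[R]_d -> \bar R}) : is_norm N -> nu setT = 1%E ->
  (forall x : 'rV[R]_d, (forall i, x 0 i <= 0) -> nu (lower_orthant x) = (expR (- N x))%:E) ->
  nu neg_orthant = 1%E.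
Proof.
move=> hN nu1 hnu.
have mneg : measurable (@neg_orthant R d).
  have -> : @neg_orthant R d = [set z | forall j, `]-oo, 0[%classic (z 0 j)].
    by apply/seteqP; split => z h j; have := h j; rewrite /= in_itv.
  exact: (@measurable_rectangle _ _ (fun=> `]-oo, 0[%classic)).
apply/eqP; rewrite eq_le; apply/andP; split.
  by rewrite -nu1; apply: le_measure; rewrite ?inE.
have N10 : 0 <= N (const_mx 1).
  have h0 : N 0 = 0 by rewrite -(scale0r (0 : 'rV[R]_d)) (is_normZ hN) normr0 mul0r.
  have := is_normD hN (const_mx 1) (- const_mx 1).
  by rewrite subrr h0 -scaleN1r (is_normZ hN) normrN1 mul1r; lra.
apply/lee_addgt0Pr => e e0.
pose r := e / (N (const_mx 1) + 1).
have r0 : 0 < r by rewrite divr_gt0// ltr_wpDl.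
have h1 : ((expR (- N (- r *: const_mx 1)))%:E <= nu neg_orthant)%E.
  rewrite -hnu; last by move=> i; rewrite !mxE mulr1 oppr_le0 ltW.
  apply: le_measure; rewrite ?inE//; first exact: measurable_lower_orthant.
  by move=> z h j; apply: le_lt_trans (h j) _; rewrite !mxE mulr1 oppr_lt0.
rewrite -leeBlDr//; apply: le_trans h1; rewrite -EFinB lee_fin.
apply: le_trans (expR_ge1Dx _); rewrite lerD2l lerN2 (is_normZ hN) normrN gtr0_norm//.
rewrite /r mulrAC ler_pdivrMr ?ltr_wpDl//.
by rewrite ler_pM2l// lerDl.
Qed.

Lemma ereal_sup_cvg0 (R : realType) (T : Type) (D : set T) (f : nat -> T -> \bar R) :
  D !=set0 -> (forall n A, 0 <= f n A)%E ->
  (forall e : R, 0 < e -> \forall n \near \oo, forall A, D A -> (f n A <= e%:E)%E) ->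
  ereal_sup [set f n A | A in D] @[n --> \oo] --> 0%E.
Proof.
move=> [A0 DA0] f0 hf.
have ge0 n : (0 <= ereal_sup [set f n A | A in D])%E.
  by apply: (@le_trans _ _ (f n A0)) => //; apply: ereal_sup_ubound; exists A0.
have hle (e : R) : 0 < e -> \forall n \near \oo, (ereal_sup [set f n A | A in D] <= e%:E)%E.
  by move=> /hf; apply: filterS => n hn; apply: ge_ereal_sup => _ [A DA <-]; exact: hn.
apply/fine_cvgP; split.
  have := hle 1 ltr01; apply: filterS => n hn.
  by rewrite ge0_fin_numE// (le_lt_trans hn)// ltry.
apply/cvgrPdist_le => e e0; have := hle e e0; apply: filterS => n hn /=.
rewrite sub0r normrN ger0_norm ?fine_ge0//.
have fn : ereal_sup [set f n A | A in D] \is a fin_num.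
  by rewrite ge0_fin_numE// (le_lt_trans hn)// ltry.
by rewrite -lee_fin fineK.
Qed.

Theorem proposition3p1 (R : realType) (d : nat) (hd : (2 <= d)%N)
    (N : 'rV[R]_d -> R) (hN : is_Dnorm N)
    (hN' : has_partials_of_order d N neg_orthant)
    (dQ : measure_display) (OQ : measurableType dQ) (Q : probability OQ R)
    (eta : 'I_d -> {RV Q >-> R})
    (heta : forall x : 'rV[R]_d, (forall i, x 0 i <= 0) ->
       joint_cdf eta x = expR (- N x))
    (dX : measure_display) (OX : measurableType dX) (PX : probability OX R)
    (X : 'I_d -> {RV PX >-> R})
    (C : 'rV[R]_d -> R) (hC : is_copula C) (hXC : has_copula X C)
    (nrm : 'rV[R]_d -> R) (hnrm : is_norm nrm)
    (hab : is_generalized_Pareto C N \/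
           (copula_expansion C N nrm /\ copula_derivatives_converge C N))
    (dO : measure_display) (Om : measurableType dO) (P : probability Om R)
    (Xs : nat -> 'I_d -> {RV P >-> R})
    (hXs_law : forall i, equal_in_law (Xs i) X)
    (hXs_ind : independent_vectors Xs)
    (c : 'I_d -> R) :
  ereal_sup [set `|P (maxima Xs n @^-1` A)
                   - Q (quantile_vector (fun j => marginal_cdf (X j)) c eta n
                          @^-1` A)|%E | A in borel]
    @[n --> \oo] --> 0%E.
Proof.
have d0 : (0 < d)%N by exact: ltnW.
have hNn : is_norm N by case: hN.
have := @choice nat (probability 'rV[R]_d R) (fun n mu => (0 < n)%N ->
    (forall x, mu (lower_orthant x) = (C (const_mx 1 + n%:R^-1 *: x) ^+ n)%:E) /\
    mu [set x : 'rV[R]_d | forall j, 0 < 1 + n%:R^-1 * x 0 j < 1] = 1%E).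
case=> [[|n]|mu_ hmu].
(* A filler for n = 0, where nothing is claimed. *)
- by exists (law Q (measurable_rvec eta)).
- by have [mu hmu] := copula_max_law hC (ltn0Sn n); exists mu.
pose nu := law Q (measurable_rvec eta).
have nuG (x : 'rV[R]_d) : (forall i, x 0 i <= 0) -> nu (lower_orthant x) = (expR (- N x))%:E.
  by move=> x0; rewrite /nu lawE joint_cdfE heta.
have nu1 : nu setT = 1%E by exact: probability_setT.
have mu1 n : mu_ n setT = 1%E by exact: probability_setT.
have nuneg : nu neg_orthant = 1%E by exact: law_neg_orthant hNn nu1 nuG.
pose s := enum 'I_d.
have us : uniq s by exact: enum_uniq.
have alls (j : 'I_d) : j \in s by rewrite mem_enum.
have hcp (x : 'rV[R]_d) (hx : neg_orthant x) := copula_power_partials hNn hnrm hN' d0 hab us hx.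
(* [heta] gives the distribution function only for nonpositive points; a neighbourhood of x consists
   of such points, which is what derivatives ask for. *)
have nuE (x : 'rV[R]_d) : neg_orthant x -> \forall y \near x, expR (- N y) = measure_cdf nu y.
  move=> /neg_orthant_near; apply: filterS => y hy.
  exact: (esym (congr1 fine (nuG y (fun i => ltW (hy i))))).
have hnu (x : 'rV[R]_d) : neg_orthant x -> has_partial s (measure_cdf nu) x /\
    partial s (fun y => expR (- N y)) x = partial s (measure_cdf nu) x.
  by move=> hx; have [h _ _] := hcp x hx; exact: has_partial_near_eq (nuE x hx) h.
have muE n : (0 < n)%N ->
    (fun y => C (const_mx 1 + n%:R^-1 *: y) ^+ n) = measure_cdf (mu_ n).
  by move=> n0; apply/funext => y; have [h _] := hmu n n0; exact: (esym (congr1 fine (h y))).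
apply: ereal_sup_cvg0 => [||e e0]; first by exists setT; exact: (@measurableT _ 'rV[R]_d).
  by move=> n A; exact: abse_ge0.
have h : forall x : 'rV[R]_d, neg_orthant x ->
    (\forall n \near \oo, has_partial s (measure_cdf (mu_ n)) x) /\
    partial s (measure_cdf (mu_ n)) x @[n --> \oo] --> partial s (measure_cdf nu) x.
  move=> x hx; have [h1 h2 h3] := hcp x hx; have [_ <-] := hnu x hx; split.
    near=> n; rewrite -muE; last by near: n; exists 1%N.
    by near: n.
  apply: cvg_trans h3; apply: near_eq_cvg; near=> n.
  by rewrite muE//; near: n; exists 1%N.
have hn := scheffe_cdf us alls nu1 mu1 nuneg (fun x hx => (hnu x hx).1) h e0.
near=> n => A bA.
have n0 : (0 < n)%N by near: n; exists 1%N.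
have [hC1 hC2] := hmu n n0.
have mq := measurable_quantile_map X c n.
have mqA : measurable ((fun x : 'rV[R]_d =>
    \row_j quantile (marginal_cdf (X j)) (c j) (1 + n%:R^-1 * x 0 j)) @^-1` A).
  by rewrite -[X in measurable X]setTI; exact: mq.
have -> : quantile_vector (fun j => marginal_cdf (X j)) c eta n @^-1` A =
    rvec eta @^-1` ((fun x : 'rV[R]_d =>
    \row_j quantile (marginal_cdf (X j)) (c j) (1 + n%:R^-1 * x 0 j)) @^-1` A).
  apply/seteqP; split => w; rewrite /preimage /= => h'.
    by congr (A _): h'; apply/rowP => j; rewrite !mxE.
  by congr (A _): h'; apply/rowP => j; rewrite !mxE.
(* Both probabilities are now the masses, under [mu_ n] and [nu], of the same preimage of A, so the
   bound, uniform over Borel sets, applies to it. *)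
have -> : P (maxima Xs n @^-1` A) = law (mu_ n) mq A.
  rewrite -(lawE P (measurable_maxima Xs n)).
  apply: measure_lower_orthant_unique => //; first by rewrite [ltLHS]probability_setT ltry.
  move=> x; apply: (eq_trans (maxima_lower_orthant hXs_law hXs_ind x n0)).
  exact: (esym (quantile_map_law hXC c x n0 (mu1 n) hC1 hC2)).
by rewrite lawE; have := near hn n; apply.
Unshelve. all: by end_near. Qed.
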